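(* Let $(E,J,R,Q,B,u,x_0,T)$ be coupled PH-DAE data (as defined in the context), let $\lambda>0$, $\alpha\in[0,1]$, $\mu\ge 0$, and let $\omega\in\mathbb{R}$ with $0\le\mu\le\omega$. Let $M$ and $N$ be the operators on $L^2_\omega([0,T],\mathbb{R}^n)$ given by $$Mx=\tfrac{\mathrm d}{\mathrm dt}(Ex)-(J_d-\alpha R+\mu EQ^{-1})Qx-Bu,\qquad x\in D(M),$$ $$D(M)=\{x\in L^2_\omega([0,T],\mathbb{R}^n)\mid Ex\in H^1([0,T],\mathbb{R}^n),\ Ex(0)=Ex_0\},$$ $$Nx=\big((1-\alpha)R+\mu EQ^{-1}-J_o\big)Qx,\qquad x\in L^2_\omega([0,T],\mathbb{R}^n).$$ Let $x^0\in D(M)$ and let the sequence $(x^k)_k$ be defined recursively by $$x^{k+1}:=Q^{-1}(I+\lambda MQ^{-1})^{-1}(I-\lambda NQ^{-1})(I+\lambda NQ^{-1})^{-1}(I-\lambda MQ^{-1})Qx^k .$$ Let $x$ be the unique (weak) solution of $\tfrac{\mathrm d}{\mathrm dt}Ex(t)=(J-R)Qx(t)+Bu(t)$, $t\in[0,T]$, $Ex(0)=Ex_0$. Then: (a) If $\mathrm{rk}\,[\mu E\ \ (1-\alpha)R]=n$, then the sequence $z^k:=(I+\lambda MQ^{-1})Qx^k$ converges to $z:=(I+\lambda MQ^{-1})Qx$ in $L^2([0,T],\mathbb{R}^n)$. Further, $(Ex^k)_k$ converges to $Ex$ in $H^1([0,T],\mathbb{R}^n)$. (b) If $\mathrm{rk}\,[\mu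 E\ \ (1-\alpha)R]=n$ or $\mathrm{rk}\,[E\ \ \alpha R]=n$, then $(x^k)_k$ converges to $x$ in $L^2([0,T],\mathbb{R}^n)$.
   Context: Coupled PH-DAE data. $T>0$, and for some $s,n_1,\dots,n_s\in\mathbb{N}$ with $n=n_1+\dots+n_s$ and some $m$, the real matrices $E,J,R,Q\in\mathbb{R}^{n\times n}$, $B\in\mathbb{R}^{n\times m}$, the input $u$ and $x_0$ satisfy: (A1) $E=\mathrm{diag}(E_1,\dots,E_s)$, $R=\mathrm{diag}(R_1,\dots,R_s)$, $Q=\mathrm{diag}(Q_1,\dots,Q_s)$ are block diagonal; $J$ has diagonal blocks $J_1,\dots,J_s$, its $(i,j)$ block for $i<j$ is $J_{ij}\in\mathbb{R}^{n_i\times n_j}$ and its $(j,i)$ block for $i<j$ is $-J_{ij}^\top$; $B$ is the vertical stack of $B_1,\dots,B_s$ with $B_i\in\mathbb{R}^{n_i\times m}$. Here $E_i,Q_i,J_i,R_i\in\mathbb{R}^{n_i\times n_i}$, $R_i=R_i^\top\ge0$, $J_i^\top=-J_i$, $E_i^\top Q_i=Q_i^\top E_i\ge 0$ (positive semidefinite), and $Q_i$ is invertible. (A2) $\mathrm{rk}\,[E\ \ R\ \ J]=n$. (A3) $u\in L^2([0,T],\mathbb{R}^m)$, $x_0\in\mathbb{R}^n$, and for matrices $Z\in\mathbb{R}^{n\times r}$, $Z_1\in\mathbb{R}^{r\times r_1}$ of full column rank with $\mathrm{im}\,Z=\ker E$ and $\mathrm{im}\,Z_1=\ker (RQZ)\cap\ker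 (Z^\top Q^\top JQZ)$, one has $Z_1^\top Z^\top Q^\top Bu\in H^1([0,T],\mathbb{R}^{r_1})$ and $Z_1^\top Z^\top Q^\top(JQx_0+Bu(0))=0$ (with $Z_1^\top Z^\top Q^\top Bu(0)$ the value at $0$ of the $H^1$ function). $J_d:=\mathrm{diag}(J_1,\dots,J_s)$ is the block-diagonal part of $J$ and $J_o:=J-J_d$ its off-block-diagonal part; both are skew-symmetric. Weak solution: $x\in L^2([0,T],\mathbb{R}^n)$ with $Ex\in H^1([0,T],\mathbb{R}^n)$, $Ex(0)=Ex_0$, and the differential-algebraic equation satisfied for almost every $t\in[0,T]$. (It exists and is unique for coupled PH-DAE data.) Here $\tfrac{\mathrm d}{\mathrm dt}Ex$ is the weak derivative of $Ex$, and point values of $Ex$ are those of its continuous representative. For $\omega\ge0$, $L^2_\omega([0,T],\mathbb{R}^n)$ is the space of $f:[0,T]\to\mathbb{R}^n$ with $t\mapsto e^{-\omega t}f(t)\in L^2([0,T],\mathbb{R}^n)$, with norm $\|f\|_{2,\omega}^2=\int_0^Te^{-2\omega t}\|f(t)\|^2\,\mathrm dt$; as a set it equals $L^2([0,T],\mathbb{R}^n)$, with equivalent norms. $[A\ \ C]$ denotes the $n\times 2n$ matrix obtained by horizontal concatenation. $Q$ and $Q^{-1}$ also denote pointwise multiplication operators. $MQ^{-1}$ has domain $Q\,D(M)$; $M$ is affine-linear. The operators $I+\lambda MQ^{-1}:Q\,D(M)\to L^2_\omega([0,T],\mathbb{R}^n)$ and $I+\lambda NQ^{-1}$ on $L^2_\omega([0,T],\mathbb{R}^n)$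 are bijective, so that the iteration is well defined with $x^k\in D(M)$ for all $k$. *)

(* Defs.v *)
From HB Require Import structures.
From mathcomp Require Import all_boot all_order all_algebra.
From mathcomp Require Import all_classical all_reals all_analysis.

Set Implicit Arguments.
Unset Strict Implicit.
Unset Printing Implicit Defensive.

Import Order.TTheory GRing.Theory Num.Theory.
Import numFieldNormedType.Exports.

Local Open Scope classical_set_scope.
Local Open Scope ring_scope.

(* Elements of L^2([0,T], R^n) are represented by functions K -> 'cV[K]_n,
   of which only the restriction to [0,T], up to null sets, is relevant. *)

Section FunctionSpaces.
Context {K : realType} (T : K) {n : nat}.
Implicit Types (f g : K -> 'cV[K]_n).

Local Notation leb := (@lebesgue_measure K).

Definition aeq f g : Prop := ae_eq leb `[0, T]%classic f g.

(* Square of the Euclidean norm; the norm `|v| of the library on matrices is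
   the maximum norm. *)
Definition sqnorm (v : 'cV[K]_n) : K := \sum_i v i ord0 ^+ 2.

Definition L2norm f : \bar K :=
  sqrte (\int[leb]_(t in `[0%R, T]) (sqnorm (f t))%:E)%E.

Definition L2 f : Prop :=
  (forall i, measurable_fun `[0, T] (fun t => f t i ord0)) /\
  (L2norm f < +oo)%E.

Definition L2w (omega : K) f : Prop :=
  L2 (fun t => expR (- omega * t) *: f t).

Definition cvg_L2 (fs : nat -> K -> 'cV[K]_n) f : Prop :=
  L2norm (fun t => fs k t - f t) @[k --> \oo] --> 0%E.

(* phi belongs to C_c^oo(]0,T[) (extended by zero) *)
Definition test_function (phi : K -> K) : Prop :=
  (forall (k : nat) (t : K), derivable (phi^`(k))%classic t 1) /\
  exists a b : K, [/\ 0 < a, b < T & forall t, t \notin `[a, b] -> phi t = 0].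

Definition is_weak_derivative f g : Prop :=
  forall phi : K -> K, test_function phi -> forall i,
    \int[leb]_(t in `[0, T]) (f t i ord0 * (phi^`())%classic t) =
    - \int[leb]_(t in `[0, T]) (g t i ord0 * phi t).

Definition H1 f : Prop :=
  L2 f /\ exists g, L2 g /\ is_weak_derivative f g.

(* The weak derivative of f in H^1; it is the zero function (a junk value)
   when f is not weakly differentiable with derivative in L^2. *)
Definition wderiv f : K -> 'cV[K]_n :=
  xget (fun=> 0) [set g | L2 g /\ is_weak_derivative f g].

Definition H1norm f : \bar K :=
  sqrte (\int[leb]_(t in `[0%R, T]) (sqnorm (f t))%:E +
         \int[leb]_(t in `[0%R, T]) (sqnorm (wderiv f t))%:E)%E.

Definition cvg_H1 (fs : nat -> K -> 'cV[K]_n) f : Prop :=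
  H1norm (fun t => fs k t - f t) @[k --> \oo] --> 0%E.

(* The continuous representative of f takes the value c at t0. *)
Definition has_value f (t0 : K) (c : 'cV[K]_n) : Prop :=
  exists F : K -> 'cV[K]_n,
    [/\ forall i, {within `[0, T], continuous (fun t : K => F t i ord0)},
        aeq f F & F t0 = c].

End FunctionSpaces.

Definition mulop {K : realType} {n p : nat} (A : 'M[K]_(p, n))
  (f : K -> 'cV[K]_n) : K -> 'cV[K]_p := fun t => A *m f t.

Definition psdmx {K : realType} {n : nat} (A : 'M[K]_n) : Prop :=
  A^T = A /\ forall v : 'cV[K]_n, 0 <= (v^T *m A *m v) ord0 ord0.

(* Column space; mxalgebra's subspaces are row spaces. *)
Definition im_mx {K : realType} {n p : nat} (A : 'M[K]_(n, p)) :
  set 'cV[K]_n := range (fun w : 'cV[K]_p => A *m w).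

Definition ker_mx {K : realType} {n p : nat} (A : 'M[K]_(n, p)) :
  set 'cV[K]_p := [set v | A *m v = 0].

(* J_ i j is the (i, j) block of J, diagonal blocks
   included. *)
Definition ph_blocks {K : realType} {s : nat} {p : 'I_s -> nat}
  (E_ : forall i, 'M[K]_(p i)) (J_ : forall i j, 'M[K]_(p i, p j))
  (R_ Q_ : forall i, 'M[K]_(p i)) : Prop :=
  [/\ forall i, psdmx (R_ i),
      forall i, (J_ i i)^T = - J_ i i,
      forall i j : 'I_s, (i < j)%N -> J_ j i = - (J_ i j)^T,
      forall i, (E_ i)^T *m Q_ i = (Q_ i)^T *m E_ i /\
                psdmx ((E_ i)^T *m Q_ i)
    & forall i, Q_ i \in unitmx].

Definition consistent_data {K : realType} (T : K) {n m : nat}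
  (E J R Q : 'M[K]_n) (B : 'M[K]_(n, m)) (u : K -> 'cV[K]_m)
  (x0 : 'cV[K]_n) : Prop :=
  exists (r r1 : nat) (Z : 'M[K]_(n, r)) (Z1 : 'M[K]_(r, r1)),
    [/\ \rank Z = r /\ \rank Z1 = r1,
        im_mx Z = ker_mx E,
        im_mx Z1 = ker_mx (R *m Q *m Z) `&` ker_mx (Z^T *m Q^T *m J *m Q *m Z),
        H1 T (mulop (Z1^T *m Z^T *m Q^T *m B) u)
      & exists c, has_value T (mulop (Z1^T *m Z^T *m Q^T *m B) u) 0 c /\
                  Z1^T *m Z^T *m Q^T *m J *m Q *m x0 + c = 0].

Definition coupled_phdae {K : realType} (T : K) {s m : nat} {p : 'I_s -> nat}
  (E_ : forall i, 'M[K]_(p i)) (J_ : forall i j, 'M[K]_(p i, p j))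
  (R_ Q_ : forall i, 'M[K]_(p i)) (B_ : forall i, 'M[K]_(p i, m))
  (E Jd J R Q : 'M[K]_(\sum_i p i)) (B : 'M[K]_(\sum_i p i, m))
  (u : K -> 'cV[K]_m) (x0 : 'cV[K]_(\sum_i p i)) : Prop :=
  [/\ 0 < T,
      [/\ E = \mxdiag_i E_ i, R = \mxdiag_i R_ i & Q = \mxdiag_i Q_ i] /\
      [/\ J = \mxblock_(i, j) J_ i j, Jd = \mxdiag_i J_ i i
        & B = \mxcol_i B_ i],
      ph_blocks E_ J_ R_ Q_,
      \rank (row_mx (row_mx E R) J) = (\sum_i p i)%N
    & L2 T u /\ consistent_data T E J R Q B u x0].

Section Operators.
Context {K : realType} (T : K) {n m : nat}.
Variables (E Jd J R Q : 'M[K]_n) (B : 'M[K]_(n, m)).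
Variables (u : K -> 'cV[K]_m) (x0 : 'cV[K]_n).
Variables (lambda alpha mu omega : K).
Implicit Types (x y : K -> 'cV[K]_n).

Definition weak_solution x : Prop :=
  [/\ L2 T x, H1 T (mulop E x), has_value T (mulop E x) 0 (E *m x0)
    & aeq T (wderiv T (mulop E x))
            (fun t => (J - R) *m Q *m x t + B *m u t)].

Definition domM : set (K -> 'cV[K]_n) :=
  [set x | [/\ L2w T omega x, H1 T (mulop E x)
             & has_value T (mulop E x) 0 (E *m x0)]].

Definition opM x : K -> 'cV[K]_n := fun t =>
  wderiv T (mulop E x) t
  - (Jd - alpha *: R + mu *: (E *m invmx Q)) *m Q *m x t - B *m u t.

Definition opN x : K -> 'cV[K]_n := fun t =>
  ((1 - alpha) *: R + mu *: (E *m invmx Q) - (J - Jd)) *m Q *m x t.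

(* I + c S Q^-1 *)
Definition IaddQ (c : K) (S : (K -> 'cV[K]_n) -> (K -> 'cV[K]_n)) y :
  K -> 'cV[K]_n := fun t => y t + c *: S (mulop (invmx Q) y) t.

(* y = S^-1 g, where S has domain D *)
Definition is_inv (D : set (K -> 'cV[K]_n))
  (S : (K -> 'cV[K]_n) -> (K -> 'cV[K]_n)) (g y : K -> 'cV[K]_n) : Prop :=
  D y /\ aeq T (S y) g.

(* x' = Q^-1 (I + lambda M Q^-1)^-1 (I - lambda N Q^-1)
          (I + lambda N Q^-1)^-1 (I - lambda M Q^-1) Q x,
   with v and y the values of the two inverses. *)
Definition iteration_step x x' : Prop :=
  exists v y : K -> 'cV[K]_n,
    [/\ is_inv (L2w T omega) (IaddQ lambda opN)
          (IaddQ (- lambda) opM (mulop Q x)) v,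
        is_inv (mulop Q @` domM) (IaddQ lambda opM)
          (IaddQ (- lambda) opN v) y
      & x' = mulop (invmx Q) y].

End Operators.

(* Main.v *)
Require Import Defs.
From HB Require Import structures.
From mathcomp Require Import all_boot all_order all_algebra.
From mathcomp Require Import all_classical all_reals all_analysis.
From mathcomp Require Import measurable_realfun ring lra.

(** Let P = E Q^-1, a symmetric positive semidefinite matrix, and let
    d^k = Q (x^k - x).  The recursion is the Peaceman-Rachford splitting, so

      |z^(k+1) - z|^2 = |z^k - z|^2 - 4 lambda <M' d^k, d^k> - 4 lambda <N v^k, v^k>,

    where M' is the linear part of M Q^-1, N stands for N Q^-1 and v^k is the
    difference of (I + lambda N)^-1 (I - lambda M Q^-1) Q x^k and Q x; both
    scalar products are nonnegative, hence both tend to 0.  With the weight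
    e^(-2(mu+1)t), the first one dominates the integral of d^T (P + alpha R) d
    and the second one is the integral of v^T (mu P + (1 - alpha) R) v; each
    rank condition makes one of these two matrices positive definite.

    The lower bound for <M' d, d> is an integration by parts for (P d)', where
    only P d is weakly differentiable.  It rests on the fact that the
    continuous representative of P d is the primitive of its weak derivative,
    obtained by testing against smooth steps, and on the product rule for
    primitives of integrable functions. *)

Set Implicit Arguments.
Unset Strict Implicit.
Unset Printing Implicit Defensive.

Import Order.TTheory GRing.Theory Num.Theory.
Import numFieldNormedType.Exports.

Local Open Scope classical_set_scope.
Local Open Scope ring_scope.

(** * Smooth steps *)

Section SmoothStep.
Context {K : realType}.
Implicit Types (f g : K -> K) (p : {poly K}).

(** The obstacle in the lower bound for <M' d, d> is that d has neither derivative nor point values,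
    and that P may be singular, so that d cannot be recovered from P d. A symmetric generalized
    inverse of P turns d^T P d into a quadratic form in P d alone. That form vanishes at 0 because
    both functions share their initial value; it is nonnegative at T because the value there still
    lies in the range of P.

    The energy identity compares integrands at almost every t, so it holds with any weight; the
    weight matters only for the sign of the M' term. No rate results: the dissipation tends to 0
    just because a decreasing sequence bounded below has vanishing increments. Under the first rank
    condition v^k tends to 0, and with it z^(k+1) - z = (I - lambda N) v^k. Expanding |d + lambda M'
    d|^2, whose cross term is nonnegative, then gives convergence of d^k and of M' d^k, hence of the
    weak derivatives. Under the second rank condition the dissipation controls d^k directly but not
    M' d^k. *)

Fixpoint ntimes_derivable (n : nat) f : Prop :=
  if n is n'.+1 then
    exists g, (forall t : K, is_derive t 1 f (g t)) /\ ntimes_derivable n' g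
  else True.

Lemma ntimes_derivableS n f : ntimes_derivable n.+1 f -> ntimes_derivable n f.
Proof.
elim: n f => //= n IHn f [g [fg gn]]; exists g; split=> //; exact: IHn.
Qed.

Lemma ntimes_derivable_cst n c : ntimes_derivable n (cst c).
Proof.
elim: n c => //= n IHn c; exists (cst 0); split=> // t; exact: is_derive_cst.
Qed.

Lemma ntimes_derivableD n f g : ntimes_derivable n f -> ntimes_derivable n g ->
  ntimes_derivable n (f \+ g).
Proof.
elim: n f g => //= n IHn f g [f' [ff' fn]] [g' [gg' gn]].
exists (f' \+ g'); split; last exact: IHn.
by move=> t; apply: is_deriveD.
Qed.

Lemma ntimes_derivableM n f g : ntimes_derivable n f -> ntimes_derivable n g ->
  ntimes_derivable n (f \* g).
Proof.
elim: n f g => // n IHn f g fn1 gn1.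
(* The product rule pairs each derivative with an undifferentiated factor, which must also qualify
   for the induction hypothesis. *)
have fn := ntimes_derivableS fn1; have gn := ntimes_derivableS gn1.
move: fn1 gn1 => /= [f' [ff' f'n]] [g' [gg' g'n]].
exists ((f \* g') \+ (g \* f')); split.
  by move=> t; apply: is_deriveM.
by apply: ntimes_derivableD; apply: IHn.
Qed.

Lemma is_derive_affine (a b t : K) : is_derive t 1 (fun s => a * s + b) a.
Proof.
have -> : (fun s => a * s + b) = (a *: id) + cst b :> (K -> K) by [].
by apply: is_derive_eq; rewrite addr0 -[RHS]mulr1.
Qed.

Lemma ntimes_derivable_affine n f (a b : K) : ntimes_derivable n f ->
  ntimes_derivable n (fun t => f (a * t + b)).
Proof.
elim: n f => //= n IHn f [f' [ff' f'n]].
exists (cst a \* (fun t => f' (a * t + b))); split.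
  move=> t; rewrite /= mulrC.
  by apply: (@is_derive1_comp _ f); last exact: is_derive_affine.
apply: ntimes_derivableM; first exact: ntimes_derivable_cst.
exact: IHn.
Qed.

(** Exhibiting the derivatives one at a time makes sums, products and affine substitutions an
    induction with no formula for iterated derivatives; here the encoding is traded for the iterated
    derivative used by [test_function]. *)
Lemma derivable_derive1n f : (forall n, ntimes_derivable n f) ->
  forall n t, derivable (f^`(n))%classic t 1.
Proof.
move=> fn n t; have := fn n.+1; clear fn; elim: n f => [|n IHn] f.
  by move=> [g [fg _]]; exact: (@ex_derive _ _ _ _ _ _ _ (fg t)).
move=> [g [fg gn]]; rewrite /derive1n iterSr.
have -> : derive1 f = g by apply/funext => s; rewrite derive1E derive_val.
exact: IHn.
Qed.

(** The polynomial parameter makes the family closed under differentiation: the derivative of p(1/t)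
    exp(-1/t) is of the same form with X^2 (p - p'), so smoothness of exp(-1/t), extended by 0,
    becomes an induction. *)
Definition flat p : K -> K :=
  fun t => if 0 < t then p.[t^-1] * expR (- t^-1) else 0.

(** Meant for the difference quotient at 0: dividing [flat p h] by h gives [flat ('X * p) h], which
    this bound sends to 0. *)
Lemma flat_le p : exists C, forall t, `|flat p t| <= C * `|t|.
Proof.
have mono i : exists C : K, forall x : K, 0 < x -> x ^+ i * expR (- x) <= C / x.
  (* From exp(x) = exp(x/(i+1))^(i+1) and exp(y) >= 1 + y >= y at y = x/(i+1). *)
  exists (i.+1 %:R ^+ i.+1) => x x0; rewrite expRN ler_pdivlMr// mulrAC -exprSr.
  rewrite ler_pdivrMr ?expR_gt0//.
  have -> : x = i.+1%:R * (x / i.+1%:R) by rewrite mulrC divfK.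
  rewrite expRM_natl exprMn ler_pM2l ?exprn_gt0 ?ltr0n//.
  have xi : 0 <= x / i.+1%:R by rewrite divr_ge0// ltW.
  rewrite ler_pXn2r ?nnegrE ?expR_ge0//.
  by rewrite (le_trans _ (expR_ge1Dx _))// lerDr.
have [C HC] := choice mono.
exists (\sum_(i < size p) `|p`_i| * C i) => t; rewrite /flat.
have C0 i : 0 <= C i.
  by have := HC i 1 ltr01; rewrite divr1 expr1n mul1r; apply/le_trans/expR_ge0.
case: ifPn => [t0|_]; last first.
  rewrite normr0 mulr_ge0//; apply: sumr_ge0 => i _; exact: mulr_ge0.
rewrite horner_coef mulr_suml mulr_suml (le_trans (ler_norm_sum _ _ _))//.
apply: ler_sum => i _; rewrite -!mulrA normrM ler_wpM2l//.
have tV : 0 < t^-1 by rewrite invr_gt0.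
have := HC i _ tV; rewrite invrK (gtr0_norm t0) ger0_norm//.
by rewrite mulr_ge0 ?expR_ge0// exprn_ge0// ltW.
Qed.

Lemma is_derive_flat p (t : K) : is_derive t 1 (flat p) (flat ('X^2 * (p - p^`())) t).
Proof.
have [t0|t0|t0] := ltgtP t 0.
- apply: (@near_eq_is_derive _ _ _ (cst 0)).
    near=> s; rewrite /flat ltNge ltW//=; near: s; exact: lt_nbhsl.
  by rewrite /flat ltNge (ltW t0)/=; exact: is_derive_cst.
- have tn0 : t != 0 by rewrite gt_eqF.
  apply: (@near_eq_is_derive _ _ _ (fun s : K => (p.[s^-1] * expR (- s^-1) : K))).
    near=> s; rewrite /flat ifT//; near: s; exact: lt_nbhsr.
  have dV : is_derive t 1 (fun s : K => s^-1) (- t ^- 2).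
    have := @is_deriveV K id t 1 1 tn0 (is_derive_id _ _).
    by move=> H; apply: is_derive_eq; rewrite -[RHS]mulr1.
  have dp := @is_derive1_comp K (horner p) _ t _ _ (is_derive_poly p t^-1) dV.
  have dN : is_derive t 1 (fun s : K => - s^-1) (t ^- 2).
    by have := is_deriveN dV; rewrite opprK.
  have de := @is_derive1_comp K expR _ t _ _ (is_derive_expR (- t^-1)) dN.
  apply: is_derive_eq (is_deriveM dp de) _.
  rewrite /flat t0 !hornerE /=.
  rewrite -[_ *: _ + _]/(p.[t^-1] * (expR (- t^-1) * t ^- 2)
    + expR (- t^-1) * (p^`().[t^-1] * - t ^- 2)).
  by rewrite -exprVn; ring.
- have flat0 q : flat q 0 = 0 by rewrite /flat ltxx.
  rewrite t0 flat0.
  suff H : h^-1 *: (flat p (h *: (1:K) + 0) - flat p 0) @[h --> (0:K)^'] --> (0:K).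
    by apply: DeriveDef; [apply/cvg_ex; exists 0|apply/cvg_lim].
  have [C HC] := flat_le ('X * p).
  have C0 : 0 <= C.
    by have := HC 1; rewrite normr1 mulr1; apply: le_trans.
  apply/cvgrPdist_le => e e0; near=> h.
  rewrite sub0r normrN flat0 subr0 addr0.
  have -> : h^-1 *: flat p (h *: 1) = flat ('X * p) h.
    rewrite /flat; have -> : h *: (1:K) = h by rewrite -[RHS]mulr1.
    case: ifP => _; rewrite ?scaler0//.
    by rewrite hornerM hornerX -mulrA.
  rewrite (le_trans (HC h))//.
  rewrite (@le_trans _ _ ((C + 1) * `|h|)) ?ler_wpM2r ?lerDl//.
  rewrite -ler_pdivlMl ?ltr_wpDl//.
  by near: h; apply: dnbhs0_le; rewrite mulr_gt0// invr_gt0 ltr_wpDl.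
Unshelve. all: by end_near. Qed.

Lemma ntimes_derivable_flat n p : ntimes_derivable n (flat p).
Proof.
elim: n p => //= n IHn p; exists (flat ('X^2 * (p - p^`()))).
by split; [exact: is_derive_flat|exact: IHn].
Qed.

Lemma flat1_ge0 t : 0 <= flat 1 t.
Proof. by rewrite /flat; case: ifP => // _; rewrite hornerC mul1r expR_ge0. Qed.

Lemma flat1_gt0 t : 0 < t -> 0 < flat 1 t.
Proof. by rewrite /flat => ->; rewrite hornerC mul1r expR_gt0. Qed.

Definition bump : K -> K := flat 1 \* (fun t => flat 1 (- 1 * t + 1)).

Lemma ntimes_derivable_bump n : ntimes_derivable n bump.
Proof.
apply: ntimes_derivableM; first exact: ntimes_derivable_flat.
exact/ntimes_derivable_affine/ntimes_derivable_flat.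
Qed.

Lemma bump_ge0 t : 0 <= bump t.
Proof. by rewrite mulr_ge0// flat1_ge0. Qed.

Lemma bump_gt0 t : 0 < t < 1 -> 0 < bump t.
Proof. by move=> /andP[t0 t1]; rewrite mulr_gt0// flat1_gt0//; lra. Qed.

Lemma bump_left t : t <= 0 -> bump t = 0.
Proof. by move=> t0; rewrite /bump/= {1}/flat ltNge t0/= mul0r. Qed.

Lemma bump_right t : 1 <= t -> bump t = 0.
Proof.
move=> t1; rewrite /bump/= {2}/flat ifF ?mulr0//.
by apply/negbTE; rewrite -leNgt mulN1r addrC subr_le0.
Qed.

Lemma continuous_bump : continuous bump.
Proof.
have [g [fg _]] := ntimes_derivable_bump 1.
move=> t; apply: differentiable_continuous; apply/derivable1_diffP.
exact: (@ex_derive _ _ _ _ _ _ _ (fg t)).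
Qed.

Lemma smooth_step : exists f, [/\ forall n, ntimes_derivable n f,
  exists f', [/\ forall t : K, is_derive t 1 f (f' t), continuous f' &
    forall t, 0 <= f' t],
  forall t, t <= 0 -> f t = 0 & forall t, 1 <= t -> f t = 1].
Proof.
(* Starting at -1 instead of 0 makes every t >= 0 interior to the interval on which the fundamental
   theorem is applied. *)
pose F (x : K) := \int[lebesgue_measure]_(t in `[-1, x]) bump t.
have ibump (u : K) : lebesgue_measure.-integrable `[-1, u] (EFin \o bump).
  apply: continuous_compact_integrable; first exact: segment_compact.
  by apply: continuous_subspaceT; exact: continuous_bump.
have F0 t : t <= 0 -> F t = 0.
  move=> t0; rewrite /F (@eq_Rintegral _ _ _ _ _ (cst 0)).
    by rewrite Rintegral_cst// mul0r.
  move=> x; rewrite inE/= in_itv/= => /andP[_ xt].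
  by rewrite bump_left// (le_trans xt).
have F' (t : K) : is_derive t 1 F (bump t).
  have [t0|t0] := ltP t 0.
    apply: (@near_eq_is_derive _ _ _ (cst 0)).
      near=> s; rewrite F0// ltW//; near: s; exact: lt_nbhsl.
    by rewrite bump_left ?ltW//; exact: is_derive_cst.
  have t1 : -1 < t by rewrite (lt_le_trans _ t0)// oppr_lt0.
  have tt1 : t < t + 1 by rewrite ltrDl.
  have [H1 H2] := continuous_FTC1_closed tt1 (ibump _) t1 (continuous_bump (x:=t)).
  by apply: DeriveDef => //; rewrite -derive1E.
have cF : continuous F.
  move=> t; apply: differentiable_continuous; apply/derivable1_diffP.
  exact: (@ex_derive _ _ _ _ _ _ _ (F' t)).
have F1 : 0 < F 1.
  rewrite -[ltLHS](F0 0)//.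
  apply: (@gtr0_derive1_lt_cc _ F 0 1); rewrite ?bound_itvE ?ler01//.
  - move=> x; rewrite in_itv/= => x01.
    by rewrite derive1E; case: (F' x) => _ ->; rewrite bump_gt0.
  - exact: continuous_subspaceT.
have F1t t : 1 <= t -> F t = F 1.
  move=> t1; rewrite /F; apply/eqP; rewrite -subr_eq0 Rintegral_itvB//.
    rewrite (@eq_Rintegral _ _ _ _ _ (cst 0)) ?Rintegral_cst ?mul0r//.
    by move=> x; rewrite inE/= in_itv/= => /andP[/ltW ? _]; rewrite bump_right.
  by rewrite bnd_simp; lra.
exists (cst (F 1)^-1 \* F); split.
- move=> [//|n]; apply: ntimes_derivableM; first exact: ntimes_derivable_cst.
  by exists bump; split=> //; exact: ntimes_derivable_bump.
- exists (cst (F 1)^-1 \* bump); split.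
  + move=> t; have := is_deriveM (is_derive_cst (F 1)^-1 t 1) (F' t).
    by move=> H; apply: is_derive_eq; rewrite scaler0 addr0.
  + move=> t; apply: continuousM; first exact: cst_continuous.
    exact: continuous_bump.
  + by move=> t; rewrite mulr_ge0 ?bump_ge0// invr_ge0 ltW.
- by move=> t t0; rewrite /= (F0 _ t0) mulr0.
- by move=> t t1; rewrite /= (F1t _ t1) mulVf// gt_eqF.
Unshelve. all: by end_near. Qed.

End SmoothStep.

(** * Continuous representatives as primitives of the weak derivative *)

Section WeakFTC.
Context {K : realType}.
Notation leb := (@lebesgue_measure K).
Implicit Types (f g F : K -> K) (T : K).

Lemma within_itv_integrable a b f : {within `[a, b], continuous f} ->
  leb.-integrable `[a, b] (EFin \o f).
Proof.
by move=> cf; apply: continuous_compact_integrable => //; exact: segment_compact.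
Qed.

Section Step.
Variables (Phi Phi' : K -> K).
Hypothesis Phin : forall n, ntimes_derivable n Phi.
Hypothesis dPhi : forall t : K, is_derive t 1 Phi (Phi' t).
Hypothesis cPhi' : continuous Phi'.
Hypothesis Phi'0 : forall t, 0 <= Phi' t.
Hypothesis Phi_left : forall t, t <= 0 -> Phi t = 0.
Hypothesis Phi_right : forall t, 1 <= t -> Phi t = 1.

Let cPhi : continuous Phi.
Proof.
move=> t; apply: differentiable_continuous; apply/derivable1_diffP.
by case: (dPhi t).
Qed.

Let Phi01 t : 0 <= Phi t <= 1.
Proof.
have [t0|t0] := leP t 0; first by rewrite Phi_left// lexx ler01.
have [t1|t1] := leP 1 t; first by rewrite Phi_right// lexx ler01.
have mono : {in `[0, 1]%R &, {homo Phi : x y / x <= y}}.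
  apply: ger0_derive1_le_cc.
  - by move=> x _; case: (dPhi x).
  - by move=> x _; rewrite derive1E; case: (dPhi x) => _ ->.
  - exact: continuous_subspaceT.
apply/andP; split.
  by rewrite -(Phi_left (lexx 0)) mono ?in_itv/= ?lexx ?ler01 ?(ltW t0) ?(ltW t1).
by rewrite -(Phi_right (lexx 1)) mono ?in_itv/= ?lexx ?ler01 ?(ltW t0) ?(ltW t1).
Qed.

(** [step c a] rises from 0 to 1 on [a, a + 1/c]. For large c it approximates the indicator of ]a,
    +oo[, and [dstep c a] a unit mass at a. *)
Let step (c a t : K) := Phi (c * t - c * a).
Let dstep (c a t : K) := c * Phi' (c * t - c * a).

Let is_derive_step c a (t : K) : is_derive t 1 (step c a) (dstep c a t).
Proof.
rewrite /dstep mulrC.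
exact: (@is_derive1_comp _ Phi _ _ _ _ _ (is_derive_affine c (- (c * a)) t)).
Qed.

Let cstep c a : continuous (step c a).
Proof.
move=> t; apply: differentiable_continuous; apply/derivable1_diffP.
by case: (is_derive_step c a t).
Qed.

Let cdstep c a : continuous (dstep c a).
Proof.
move=> t; apply: continuousM; first exact: cst_continuous.
apply: (@continuous_comp _ _ _ (fun s => c * s - c * a) Phi'); last exact: cPhi'.
apply: differentiable_continuous; apply/derivable1_diffP.
by case: (is_derive_affine c (- (c * a)) t).
Qed.

Let step_left c a t : 0 < c -> t <= a -> step c a t = 0.
Proof. by move=> c0 ta; rewrite /step Phi_left// subr_le0 ler_pM2l. Qed.

Let step_right c a t : 0 < c -> a + c^-1 <= t -> step c a t = 1.
Proof.
move=> c0 ta; rewrite /step Phi_right// -mulrBr -ler_pdivrMl// mulr1.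
by rewrite lerBrDl.
Qed.

Let dstep_out c a t : 0 < c -> t < a \/ a + c^-1 < t -> dstep c a t = 0.
Proof.
move=> c0 ta; suff <- : 'D_1 (step c a) t = dstep c a t.
  suff [_ ->] : is_derive t 1 (step c a) (0 : K) by [].
  case: ta => ta.
    apply: (@near_eq_is_derive _ _ _ (cst (0 : K))).
    near=> s; rewrite step_left// ltW//; near: s; exact: lt_nbhsl.
  apply: (@near_eq_is_derive _ _ _ (cst (1 : K))).
  near=> s; rewrite step_right// ltW//; near: s; exact: lt_nbhsr.
by case: (is_derive_step c a t).
Unshelve. all: by end_near. Qed.

Let dstep_ge0 c a t : 0 < c -> 0 <= dstep c a t.
Proof. by move=> c0; rewrite mulr_ge0// ltW. Qed.

Let dstep_mass T c a : 0 < c -> 0 < a -> a + c^-1 < T ->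
  \int[leb]_(t in `[0, T]) dstep c a t = 1.
Proof.
move=> c0 a0 aT; have T0 : 0 < T by rewrite (lt_trans _ aT)// addr_gt0// invr_gt0.
rewrite /Rintegral (@continuous_FTC2 _ _ (step c a))//.
- by rewrite (step_left c0 (ltW a0)) (step_right c0 (ltW aT))/= subr0.
- by apply: continuous_subspaceT; exact: cdstep.
- split; first by move=> x _; case: (is_derive_step c a x).
  + exact/cvg_at_right_filter/cstep.
  + exact/cvg_at_left_filter/cstep.
- by move=> x _; rewrite derive1E; case: (is_derive_step c a x).
Qed.

(** [dstep] is nonnegative, of total mass 1, and lives on an interval of width d/(n+1) to the right
    of a, so continuity of F at a suffices. The parameter d keeps that interval inside [0, T] from n
    = 0 on. *)
Let cvg_dstep T F a d : 0 < a -> a < T -> 0 < d -> a + d < T ->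
  {within `[0, T], continuous F} ->
  \int[leb]_(t in `[0, T]) (F t * dstep (n.+1%:R / d) a t) @[n --> \oo] --> F a.
Proof.
move=> a0 aT d0 adT cF; apply/cvgrPdist_le => e e0.
have cn n : 0 < n.+1%:R / d by rewrite divr_gt0.
have acT n : a + (n.+1%:R / d)^-1 < T.
  rewrite (le_lt_trans _ adT)// lerD2l invf_div ler_pdivrMr//.
  by rewrite ler_pMr// ler1n.
have [r r0 Fr] : exists2 r, 0 < r & forall t, `|a - t| < r -> `|F a - F t| <= e.
  have := cF; rewrite continuous_within_itvP ?(lt_trans a0)// => -[+ _ _].
  move=> /(_ a); rewrite in_itv/= a0 aT => /(_ isT) /cvgrPdist_le /(_ e e0).
  by move=> [r /= r0 Hr]; exists r.
near=> n.
have c0 := cn n; have acTn := acT n.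
have nr : (n.+1%:R / d)^-1 < r.
  rewrite invf_div ltr_pdivrMr// mulrC -ltr_pdivrMr//.
  rewrite (@lt_trans _ _ n%:R) ?ltr_nat//.
  by near: n; exact: nbhs_infty_gtr.
move: c0 acTn nr; set c := n.+1%:R / d => c0 acTn nr.
have cD : {within `[0, T], continuous (dstep c a)}.
  by apply: continuous_subspaceT; exact: cdstep.
have cFD : {within `[0, T], continuous (fun t => F t * dstep c a t)}.
  by move=> x; apply: continuousM; [exact: cF|exact: cD].
have iD := within_itv_integrable cD; have iFD := within_itv_integrable cFD.
have iaD : leb.-integrable `[0, T] (EFin \o (fun t => F a * dstep c a t)).
  apply: within_itv_integrable => x; apply: continuousM; last exact: cD.
  exact: cst_continuous.
have ieD : leb.-integrable `[0, T] (EFin \o (fun t => e * dstep c a t)).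
  apply: within_itv_integrable => x; apply: continuousM; last exact: cD.
  exact: cst_continuous.
rewrite -[F a](mulr1) -(dstep_mass c0 a0 acTn) -RintegralZl//.
rewrite -RintegralB//.
have iB : leb.-integrable `[0, T] (EFin \o (fun t =>
    F a * dstep c a t - F t * dstep c a t)).
  by apply: eq_integrable (integrableB _ iaD iFD).
rewrite (le_trans (le_normr_Rintegral _ iB))//.
rewrite -[leRHS]mulr1 -(dstep_mass c0 a0 acTn) -RintegralZl//.
apply: le_Rintegral => //; first exact: integrable_norm.
move=> t _; rewrite -mulrBl normrM [`|dstep _ _ _|]ger0_norm ?dstep_ge0//.
have [ta|ta] := ltP t a; first by rewrite dstep_out//; [rewrite !mulr0|left].
have [tb|tb] := ltP (a + c^-1) t.
  by rewrite dstep_out//; [rewrite !mulr0|right].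
rewrite ler_wpM2r ?dstep_ge0// Fr// distrC ger0_norm ?subr_ge0//.
by rewrite (le_lt_trans _ nr)// lerBlDl.
Unshelve. all: by end_near. Qed.

(** Dominated convergence with bound |g|. The step vanishes at a itself, so its limit is the
    indicator of ]a, T]; the integral of g over that interval is written as a difference. *)
Let cvg_step T g a d : 0 < a -> a < T -> 0 < d ->
  leb.-integrable `[0, T] (EFin \o g) ->
  \int[leb]_(t in `[0, T]) (g t * step (n.+1%:R / d) a t) @[n --> \oo] -->
  \int[leb]_(t in `[0, T]) g t - \int[leb]_(t in `[0, a]) g t.
Proof.
move=> a0 aT d0 ig.
have mg : measurable_fun `[0, T] g by apply/measurable_EFinP; exact: measurable_int ig.
have mst c : measurable_fun `[0, T] (step c a).
  by apply: measurable_funTS; apply: continuous_measurable_fun; exact: cstep.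
rewrite Rintegral_itvB//; last 2 first.
- by rewrite bnd_simp ltW.
- by rewrite bnd_simp ltW.
have -> : \int[leb]_(x in `]a, T]) g x =
    \int[leb]_(t in `[0, T]) (g t * \1_(`]a, T]) t).
  have -> : `]a, T]%classic = `[0, T] `&` `]a, T].
    apply/seteqP; split=> [x|x []//]; rewrite /= !in_itv/= => /andP[ax xT].
    by rewrite ax xT (ltW (lt_trans a0 ax)).
  rewrite Rintegral_mkcondr; apply: eq_Rintegral => x x0T.
  rewrite patchE indicE in_setI x0T /=.
  by case: (_ \in _); rewrite ?mulr1 ?mulr0.
have iag : leb.-integrable `[0, T] (EFin \o (fun t => `|g t|)) by exact: integrable_norm.
apply: fine_cvg; rewrite fineK; last first.
  apply: integrable_fin_num => //.
  apply: le_integrable ig => //.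
    apply/measurable_EFinP/measurable_funM => //; exact: measurable_indic.
  move=> x _ /=; rewrite lee_fin normrM indicE.
  by case: (_ \in _); rewrite ?normr1 ?normr0 ?mulr1 ?mulr0.
refine (@dominated_cvg _ _ _ leb `[0, T] _ (fun n t => (g t * step (n.+1%:R / d) a t)%:E)
  (fun t => (g t * \1_(`]a, T]) t)%:E) (EFin \o (fun t => `|g t|)) _ _ _ _ _) => //.
- by move=> n; apply/measurable_EFinP; apply: measurable_funM => //; exact: mst.
- move=> t t0T; apply/cvg_EFin; first by near=> n.
  apply: cvgM; first exact: cvg_cst.
  have [ta|ta] := leP t a.
    rewrite indicE memNset; last first.
      by rewrite /= in_itv/= => /andP[/lt_le_trans/(_ ta)]; rewrite ltxx.
    apply: cvg_near_cst; near=> n; apply: step_left => //.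
    by rewrite divr_gt0.
  rewrite indicE mem_set; last first.
    by move: t0T; rewrite /= !in_itv/= ta => /andP[].
  apply: cvg_near_cst; near=> n; apply: step_right; first by rewrite divr_gt0.
  rewrite -lerBrDl invf_div ler_pdivrMr// mulrC -ler_pdivrMr ?subr_gt0//.
  rewrite (@le_trans _ _ n%:R) ?ler_nat//.
  by near: n; exact: nbhs_infty_ger.
- move=> n x _ /=; rewrite lee_fin normrM ler_piMr// ger0_norm.
    by case/andP: (Phi01 ((n.+1%:R / d) * x - (n.+1%:R / d) * a)).
  by case/andP: (Phi01 ((n.+1%:R / d) * x - (n.+1%:R / d) * a)).
Unshelve. all: by end_near. Qed.


(** The test functions are plateaus tending to the indicator of ]a, b]. Their derivatives tend to a
    unit mass at a minus one at b, so the weak identity becomes in the limit F a - F b = - (integral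
    of g over ]a, b]). *)
Let weak_FTC_oo T f g F a b : {within `[0, T], continuous F} ->
  ae_eq leb `[0, T]%classic f F -> measurable_fun `[0, T] f ->
  leb.-integrable `[0, T] (EFin \o g) ->
  (forall phi, test_function T phi ->
    \int[leb]_(t in `[0, T]) (f t * (phi^`())%classic t) =
    - \int[leb]_(t in `[0, T]) (g t * phi t)) ->
  0 < a -> a < b -> b < T ->
  F b - \int[leb]_(t in `[0, b]) g t = F a - \int[leb]_(t in `[0, a]) g t.
Proof.
move=> cF fF mf ig wfg a0 ab bT.
have aT := lt_trans ab bT; have b0 := lt_trans a0 ab.
(* The plateau descends between b and b + d, so its support stays away from T. *)
pose d := (T - b) / 2.
have d0 : 0 < d by rewrite divr_gt0// subr_gt0.
have bdT : b + d < T by rewrite /d; lra.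
have adT : a + d < T by rewrite (lt_trans _ bdT)// ltrD2r.
pose c n : K := n.+1%:R / d.
have c0 n : 0 < c n by rewrite divr_gt0.
have cd n : (c n)^-1 <= d.
  by rewrite invf_div ler_pdivrMr// ler_pMr// ler1n.
pose phi n : K -> K := step (c n) a \+ (cst (-1) \* step (c n) b).
have phin n : test_function T (phi n).
  split.
    move=> k t; apply: derivable_derive1n => m.
    apply: ntimes_derivableD; first exact: ntimes_derivable_affine.
    apply: ntimes_derivableM; first exact: ntimes_derivable_cst.
    exact: ntimes_derivable_affine.
  exists a, (b + d); split=> // t; rewrite in_itv/= negb_and -!ltNge /phi/=.
  case/orP => [ta|tb].
    by rewrite !step_left ?(ltW ta) ?(ltW (lt_trans ta ab))// mulr0 addr0.
  rewrite !step_right ?mulr1 ?subrr// (le_trans _ (ltW tb))// lerD//.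
  exact: ltW.
have dphi n (t : K) : (phi n)^`()%classic t = dstep (c n) a t - dstep (c n) b t.
  have := is_deriveD (is_derive_step (c n) a t)
    (is_deriveM (is_derive_cst (-1 : K) t 1) (is_derive_step (c n) b t)).
  case=> _ H; rewrite derive1E [LHS]H scaler0 addr0.
  by rewrite -[X in _ + X]/(-1 * dstep (c n) b t) mulN1r.
have cD n e : {within `[0, T], continuous (dstep (c n) e)}.
  by apply: continuous_subspaceT; exact: cdstep.
have iFD n e : leb.-integrable `[0, T] (EFin \o (fun t => F t * dstep (c n) e t)).
  by apply: within_itv_integrable => x; apply: continuousM; [exact: cF|exact: cD].
have mg : measurable_fun `[0, T] g by apply/measurable_EFinP; exact: measurable_int ig.
have mst n e : measurable_fun `[0, T] (step (c n) e).
  by apply: measurable_funTS; apply: continuous_measurable_fun; exact: cstep.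
have igs n e : leb.-integrable `[0, T] (EFin \o (fun t => g t * step (c n) e t)).
  apply: le_integrable ig => //.
    by apply/measurable_EFinP; apply: measurable_funM => //; exact: mst.
  move=> x _ /=; rewrite lee_fin normrM ler_piMr// ger0_norm.
    by case/andP: (Phi01 (c n * x - c n * e)).
  by case/andP: (Phi01 (c n * x - c n * e)).
have key n : \int[leb]_(t in `[0, T]) (F t * dstep (c n) a t) -
    \int[leb]_(t in `[0, T]) (F t * dstep (c n) b t) =
   - (\int[leb]_(t in `[0, T]) (g t * step (c n) a t) -
      \int[leb]_(t in `[0, T]) (g t * step (c n) b t)).
  rewrite -!RintegralB//.
  transitivity (\int[leb]_(t in `[0, T]) (f t * (phi n)^`()%classic t)).
    congr fine; apply: ae_eq_integral => //.
    - have := integrableB _ (iFD n a) (iFD n b) => /(_ (measurable_itv _)).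
      by move/measurable_int.
    - apply/measurable_EFinP; apply: measurable_funM => //.
      rewrite (_ : derive1 _ = dstep (c n) a \- dstep (c n) b).
        apply: measurable_funTS; apply: measurable_funB;
        apply: continuous_measurable_fun; exact: cdstep.
      by apply/funext => t; rewrite dphi.
    - apply: filterS fF => t H Dt; rewrite H// dphi mulrBr//.
  rewrite wfg//; congr (- _); apply: eq_Rintegral => t _.
  by rewrite /phi/= mulN1r mulrBr.
pose U n := \int[leb]_(t in `[0, T]) (F t * dstep (c n) a t) -
    \int[leb]_(t in `[0, T]) (F t * dstep (c n) b t).
have L : U n @[n --> \oo] --> F a - F b.
  exact: cvgB (cvg_dstep a0 aT d0 adT cF) (cvg_dstep b0 bT d0 bdT cF).
have R : U n @[n --> \oo] -->
    - ((\int[leb]_(t in `[0, T]) g t - \int[leb]_(t in `[0, a]) g t) -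
       (\int[leb]_(t in `[0, T]) g t - \int[leb]_(t in `[0, b]) g t)).
  rewrite (_ : U = fun n => - (\int[leb]_(t in `[0, T]) (g t * step (c n) a t) -
      \int[leb]_(t in `[0, T]) (g t * step (c n) b t))); last first.
    by apply/funext => n; exact: key.
  exact: cvgN (cvgB (cvg_step a0 aT d0 ig) (cvg_step b0 bT d0 ig)).
have E : F a - F b =
    - ((\int[leb]_(t in `[0, T]) g t - \int[leb]_(t in `[0, a]) g t) -
       (\int[leb]_(t in `[0, T]) g t - \int[leb]_(t in `[0, b]) g t)).
  exact: norm_cvg_unique L R.
lra.
Qed.

Lemma weak_FTC_from_step T f g F : 0 < T -> {within `[0, T], continuous F} ->
  ae_eq leb `[0, T]%classic f F -> measurable_fun `[0, T] f ->
  leb.-integrable `[0, T] (EFin \o g) ->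
  (forall phi, test_function T phi ->
    \int[leb]_(t in `[0, T]) (f t * (phi^`())%classic t) =
    - \int[leb]_(t in `[0, T]) (g t * phi t)) ->
  forall t, 0 <= t <= T -> F t = F 0 + \int[leb]_(t in `[0, t]) g t.
Proof.
move=> T0 cF fF mf ig wfg.
pose H t := F t - \int[leb]_(t in `[0, t]) g t.
have cH : {within `[0, T], continuous H}.
  apply/subspace_continuousP => x Tx; apply: cvgB.
    by move/subspace_continuousP : cF; exact.
  have := parameterized_integral_continuous (ltW T0) ig.
  by move/subspace_continuousP; exact.
pose m := T / 2.
have m0 : 0 < m by rewrite divr_gt0.
have mT : m < T by rewrite /m; lra.
have Hm t : 0 < t -> t < T -> H t = H m.
  move=> t0 tT; have [tm|tm|->//] := ltgtP t m.
    by symmetry; exact: (weak_FTC_oo cF fF mf ig wfg).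
  exact: (weak_FTC_oo cF fF mf ig wfg).
(* Test functions vanish near 0 and T, hence do not see the endpoints; these are reached by
   one-sided continuity. *)
have := cH; rewrite continuous_within_itvP// => -[_ H0 HT].
have E0 : H 0 = H m.
  apply: (norm_cvg_unique H0); apply: cvg_near_cst; near=> x; apply: Hm.
    by [].
  by near: x; exact: nbhs_right_lt.
have ET : H T = H m.
  apply: (norm_cvg_unique HT); apply: cvg_near_cst; near=> x; apply: Hm.
    by near: x; exact: nbhs_left_gt.
  by [].
move=> t /andP[]; rewrite le_eqVlt => /predU1P[<- _|t0].
  by rewrite set_itv1 Rintegral_set1 addr0.
have H0E : H 0 = F 0 by rewrite /H set_itv1 Rintegral_set1 subr0.
have Ht : H t = F t - \int[leb]_(t in `[0, t]) g t by [].
rewrite le_eqVlt => /predU1P[tT|tT]; last by have := Hm _ t0 tT; lra.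
by move: Ht; rewrite tT; lra.
Unshelve. all: by end_near. Qed.

End Step.

Lemma weak_FTC T f g F : 0 < T -> {within `[0, T], continuous F} ->
  ae_eq leb `[0, T]%classic f F -> measurable_fun `[0, T] f ->
  leb.-integrable `[0, T] (EFin \o g) ->
  (forall phi, test_function T phi ->
    \int[leb]_(t in `[0, T]) (f t * (phi^`())%classic t) =
    - \int[leb]_(t in `[0, T]) (g t * phi t)) ->
  forall t, 0 <= t <= T -> F t = F 0 + \int[leb]_(t in `[0, t]) g t.
Proof.
have [Phi [Phin [Phi' [dPhi cPhi' Phi'0]] Phi_left Phi_right]] := @smooth_step K.
exact: (weak_FTC_from_step Phin dPhi).
Qed.

(** By Lebesgue differentiation the primitive of the zero extension of g has derivative g almost
    everywhere, while it is constantly 0 to the left of T. *)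
Lemma ae_eq0_of_primitive T g : leb.-integrable `[0, T] (EFin \o g) ->
  (forall t, 0 <= t <= T -> \int[leb]_(t in `[0, t]) g t = 0) ->
  ae_eq leb `[0, T]%classic g (cst 0).
Proof.
move=> ig g0.
have [T0|T0] := leP T 0.
  have m0 : leb `[0, T]%classic = 0%E.
    by rewrite lebesgue_measure_itv/= lte_fin ltNge T0.
  exact: ae_eq0.
have ig' : leb.-integrable setT (EFin \o (g \_ `[0, T])).
  by rewrite -restrict_EFin; apply/integrable_restrict => //=; rewrite setTI.
have igN y : leb.-integrable [set` Interval -oo%O (BRight y)] (EFin \o (g \_ `[0, T])).
  exact: integrableS ig'.
have gF := FTC1 igN (integrable_locally (measurable_itv _) ig).
have gI t : t < T -> \int[leb]_(x in `]-oo, t]) (g \_ `[0, T]) x = 0.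
  move=> tT; rewrite -Rintegral_mkcondr.
  have [t0|t0] := ltP t 0.
    rewrite (_ : _ `&` _ = set0) ?Rintegral_set0//.
    apply/seteqP; split=> // x; rewrite /= !in_itv/= => -[xt /andP[x0 _]].
    by have := le_lt_trans (le_trans x0 xt) t0; rewrite ltxx.
  rewrite -[RHS](g0 t) ?t0 ?ltW//; congr (Rintegral _ _ _).
  apply/seteqP; split=> x; rewrite /= !in_itv/=.
    by move=> [-> /andP[->]].
  by move=> /andP[-> xt]; rewrite xt (le_trans xt (ltW tT)).
have nT : {ae leb, forall x, ~ [set 0; T] x}.
  exists [set 0; T]; split.
  - by apply: measurableU.
  - apply: countable_lebesgue_measure0; apply: finite_set_countable.
    exact: finite_set2.
  - by move=> x /= /contrapT.
refine (@filterS2 _ _ (ae_filter_ringOfSetsType leb) _ _ _ _ gF nT).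
move=> x /(_ (ltNyr _)) [_ Fx] xn /=; rewrite in_itv/= => /andP[x0 xT].
have xltT : x < T by rewrite lt_neqAle xT andbT; apply/eqP => ?; apply: xn; right.
move: Fx; rewrite derive1E (@near_eq_derive _ _ _ _ (cst 0)).
  by rewrite derive_cst patchE mem_set//= in_itv/= x0 xT.
by near=> y; apply: gI; near: y; exact: lt_nbhsl.
Unshelve. all: by end_near. Qed.

End WeakFTC.

(** * Primitives of integrable functions *)

Section Primitive.
Context {K : realType}.
Notation leb := (@lebesgue_measure K).
Implicit Types (a b f g : K -> K) (T : K).

Lemma integrableD_itv (i : interval K) f g : leb.-integrable [set` i] (EFin \o f) ->
  leb.-integrable [set` i] (EFin \o g) ->
  leb.-integrable [set` i] (EFin \o (fun t => f t + g t)).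
Proof. by move=> i1 i2; exact: (integrableD _ i1 i2). Qed.

Lemma integrableB_itv (i : interval K) f g : leb.-integrable [set` i] (EFin \o f) ->
  leb.-integrable [set` i] (EFin \o g) ->
  leb.-integrable [set` i] (EFin \o (fun t => f t - g t)).
Proof. by move=> i1 i2; exact: (integrableB _ i1 i2). Qed.

Lemma integrableZ_itv (i : interval K) c f : leb.-integrable [set` i] (EFin \o f) ->
  leb.-integrable [set` i] (EFin \o (fun t => c * f t)).
Proof. by move=> i1; exact: (integrableZl _ c i1). Qed.

(** Absolute continuity of A on [0, T], with a as its derivative almost everywhere. *)
Definition primitive_on T a (A : K -> K) :=
  leb.-integrable `[0, T] (EFin \o a) /\
  forall t, 0 <= t <= T -> A t = A 0 + \int[leb]_(t in `[0, t]) a t.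

Lemma primitive_on_continuous T a A : 0 <= T -> primitive_on T a A ->
  {within `[0, T], continuous A}.
Proof.
move=> T0 [ia HA].
have cI : {within `[0, T], continuous (fun t => A 0 + \int[leb]_(t in `[0, t]) a t)}.
  apply/subspace_continuousP => x Tx; apply: cvgD; first exact: cvg_cst.
  have := parameterized_integral_continuous T0 ia.
  by move/subspace_continuousP; exact.
have E : {in `[0, T]%classic, (fun t => A 0 + \int[leb]_(t in `[0, t]) a t) =1 A}.
  by move=> t; rewrite inE/= in_itv/= => tT; rewrite [RHS]HA.
exact: (subspace_eq_continuous E cI).
Qed.

Lemma primitive_onB T a A s t : primitive_on T a A -> 0 <= s -> s <= t -> t <= T ->
  A t - A s = \int[leb]_(r in `]s, t]) a r.
Proof.
move=> [ia HA] s0 st tT.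
have s0T : 0 <= s <= T by rewrite s0 (le_trans st).
have t0T : 0 <= t <= T by rewrite (le_trans s0).
rewrite (HA _ s0T) (HA _ t0T).
rewrite opprD addrACA subrr add0r Rintegral_itvB// ?bnd_simp//.
by apply: integrableS ia => //; apply: subset_itvl; rewrite bnd_simp.
Qed.

Lemma bounded_within_itv T f : {within `[0, T], continuous f} ->
  [bounded f x | x in `[0, T]%classic].
Proof.
move=> cf; have := continuous_compact cf (@segment_compact _ 0 T).
move=> /compact_bounded [M [Mr HM]]; exists M; split=> // y My x Tx.
by apply: (HM y My); exists x.
Qed.

Lemma integrable_mul_continuous T f g : {within `[0, T], continuous f} ->
  leb.-integrable `[0, T] (EFin \o g) ->
  leb.-integrable `[0, T] (EFin \o (f \* g)).
Proof.
move=> cf ig; have mf : measurable_fun `[0, T] f.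
  exact: subspace_continuous_measurable_fun.
exact: (@integrableMr _ _ _ leb _ (measurable_itv _) _ _ mf (bounded_within_itv cf) ig).
Qed.

(** The defect D = A B - (integral of f) has increments of second order: they are bounded by squared
    increments of H, the primitive of |a| + |b|. As H is continuous and monotone, subdividing at its
    intermediate values makes this bound arbitrarily small, so D is constant. *)
Lemma primitive_onM T a A b B : 0 <= T -> primitive_on T a A -> primitive_on T b B ->
  primitive_on T (fun t => a t * B t + A t * b t) (fun t => A t * B t).
Proof.
move=> T0 pa pb; have [[ia _] [ib _]] := (pa, pb).
have cA := primitive_on_continuous T0 pa; have cB := primitive_on_continuous T0 pb.
set f := fun t => a t * B t + A t * b t.
have ifT : leb.-integrable `[0, T] (EFin \o f).
  have i1 := integrable_mul_continuous cB ia.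
  have i2 := integrable_mul_continuous cA ib.
  have := integrableD_itv i1 i2.
  by congr (is_true (leb.-integrable _ (EFin \o _))); apply/funext => t; rewrite /f mulrC.
split=> //.
pose h t := `|a t| + `|b t|.
have ih : leb.-integrable `[0, T] (EFin \o h).
  exact: integrableD_itv (integrable_norm ia) (integrable_norm ib).
pose H t := \int[leb]_(t in `[0, t]) h t.
have pH : primitive_on T h H.
  by split=> // t _; rewrite {2}/H set_itv1 Rintegral_set1 add0r.
pose D t := A t * B t - \int[leb]_(t in `[0, t]) f t.
have pD : primitive_on T f (fun t => \int[leb]_(t in `[0, t]) f t).
  by split=> // t _; rewrite set_itv1 Rintegral_set1 add0r.
have sub s t : 0 <= s -> t <= T -> `]s, t] `<=` `[0, T].
  move=> s0 tT x; rewrite /= !in_itv/= => /andP[sx xt].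
  by rewrite (le_trans s0 (ltW sx)) (le_trans xt tT).
have Hmono s t : 0 <= s -> s <= t -> t <= T -> H s <= H t.
  move=> s0 st tT; rewrite -subr_ge0 (primitive_onB pH)//.
  by apply: Rintegral_ge0 => x _; rewrite addr_ge0.
have incr c C s t : primitive_on T c C -> (forall r, `|c r| <= h r) ->
    0 <= s -> s <= t -> t <= T -> `|C t - C s| <= H t - H s.
  move=> pc ch s0 st tT; rewrite (primitive_onB pc)// (primitive_onB pH)//.
  have ic : leb.-integrable `]s, t] (EFin \o c).
    by apply: integrableS pc.1 => //; exact: sub.
  rewrite (le_trans (le_normr_Rintegral _ ic))//.
  apply: le_Rintegral => //; first exact: integrable_norm.
  by apply: integrableS ih => //; exact: sub.
have ah r : `|a r| <= h r by rewrite lerDl.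
have bh r : `|b r| <= h r by rewrite lerDr.
have D1 s t : 0 <= s -> s <= t -> t <= T -> `|D t - D s| <= (H t - H s) ^+ 2.
  move=> s0 st tT.
  have iS c : leb.-integrable `[0, T] (EFin \o c) -> leb.-integrable `]s, t] (EFin \o c).
    by move=> ic; apply: integrableS ic => //; exact: sub.
  (* Uses A t B t - A s B s = B t (A t - A s) + A s (B t - B s), where each increment is an integral
     over ]s, t]. *)
  have -> : D t - D s = \int[leb]_(r in `]s, t]) (B t * a r + A s * b r - f r).
    rewrite RintegralB//; [|apply: integrableD_itv; apply: integrableZ_itv; exact: iS|exact: iS].
    rewrite RintegralD//; [|by apply: integrableZ_itv; exact: iS..].
    rewrite !RintegralZl//; [|exact: iS..].
    by rewrite -(primitive_onB pa)// -(primitive_onB pb)// -(primitive_onB pD)// /D; ring.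
  have ig : leb.-integrable `]s, t] (EFin \o (fun r => B t * a r + A s * b r - f r)).
    apply: integrableB_itv; last exact: iS.
    by apply: integrableD_itv; apply: integrableZ_itv; exact: iS.
  rewrite (le_trans (le_normr_Rintegral _ ig))//.
  rewrite expr2 {2}(primitive_onB pH)// -RintegralZl//; last exact: iS.
  apply: le_Rintegral => //; [exact: integrable_norm|by apply: integrableZ_itv; exact: iS|].
  move=> r; rewrite /= in_itv/= => /andP[/ltW sr rt].
  have r0 := le_trans s0 sr; have rT := le_trans rt tT.
  have -> : B t * a r + A s * b r - f r = a r * (B t - B r) - (A r - A s) * b r.
    by rewrite /f; ring.
  rewrite (le_trans (ler_normB _ _))// !normrM /h mulrDr lerD//.
    rewrite mulrC ler_wpM2r// (le_trans (incr _ _ _ _ pb bh r0 rt tT))//.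
    by rewrite lerD2l lerN2 Hmono.
  rewrite ler_wpM2r// (le_trans (incr _ _ _ _ pa ah s0 sr rT))//.
  by rewrite lerD2r Hmono.
(* halving [H t - H s] halves the bound on [D t - D s] *)
have Dn n : forall s t, 0 <= s -> s <= t -> t <= T ->
    `|D t - D s| <= 2 ^- n * (H t - H s) ^+ 2.
  elim: n => [|n IHn] s t s0 st tT; first by rewrite expr0 invr1 mul1r D1.
  have cH : {within `[s, t], continuous H}.
    apply: continuous_subspaceW (primitive_on_continuous T0 pH).
    by apply: subset_itv; rewrite bnd_simp.
  have Hst := Hmono _ _ s0 st tT.
  have [r] : exists2 r, r \in `[s, t] & H r = (H s + H t) / 2.
    by apply: IVT => //; rewrite min_l ?max_r//; apply/andP; split; lra.
  rewrite in_itv/= => /andP[sr rt] Hr.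
  have -> : D t - D s = (D t - D r) + (D r - D s) by ring.
  have r0 := le_trans s0 sr; have rT := le_trans rt tT.
  rewrite (le_trans (ler_normD _ _))// (le_trans (lerD (IHn _ _ r0 rt tT) (IHn _ _ s0 sr rT)))//.
  rewrite Hr [2 ^+ n.+1]exprS invfM.
  have -> : H t - (H s + H t) / 2 = (H t - H s) / 2 by field.
  have -> : (H s + H t) / 2 - H s = (H t - H s) / 2 by field.
  rewrite le_eqVlt; apply/orP; left; apply/eqP; set q := 2 ^- n; field => //.
move=> t /andP[t0 tT].
have : D t = D 0.
  apply/eqP; rewrite -subr_eq0 -normr_le0.
  have cv : geometric ((H t - H 0) ^+ 2) 2^-1 n @[n --> \oo] --> (0 : K).
    by apply: cvg_geometric; rewrite ger0_norm ?invr_ge0// invf_lt1// ltr1n.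
  apply: (cvgr_to_ge cv); apply: nearW => n.
  by rewrite /geometric/= mulrC exprVn Dn.
by rewrite /D set_itv1 Rintegral_set1 subr0 => <-; rewrite subrK.
Qed.

End Primitive.

(** * Square-integrable functions *)

Section Dot.
Context {K : realType} {n : nat}.
Implicit Types (u v w : 'cV[K]_n) (A : 'M[K]_n).

Definition dot u v : K := \sum_i u i ord0 * v i ord0.

Lemma sqnormE v : sqnorm v = dot v v.
Proof. by apply: eq_bigr => i _; rewrite expr2. Qed.

Lemma dotE u v : dot u v = (u^T *m v) ord0 ord0.
Proof. by rewrite mxE; apply: eq_bigr => i _; rewrite mxE. Qed.

Lemma dotC u v : dot u v = dot v u.
Proof. by apply: eq_bigr => i _; rewrite mulrC. Qed.

Lemma dotDl u v w : dot (u + v) w = dot u w + dot v w.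
Proof. by rewrite -big_split; apply: eq_bigr => i _; rewrite !mxE mulrDl. Qed.

Lemma dotDr u v w : dot w (u + v) = dot w u + dot w v.
Proof. by rewrite dotC dotDl !(dotC w). Qed.

Lemma dotNl u w : dot (- u) w = - dot u w.
Proof. by rewrite -sumrN; apply: eq_bigr => i _; rewrite !mxE mulNr. Qed.

Lemma dotNr u w : dot w (- u) = - dot w u.
Proof. by rewrite dotC dotNl (dotC w). Qed.

Lemma dotZl c u w : dot (c *: u) w = c * dot u w.
Proof. by rewrite mulr_sumr; apply: eq_bigr => i _; rewrite !mxE mulrA. Qed.

Lemma dotZr c u w : dot w (c *: u) = c * dot w u.
Proof. by rewrite dotC dotZl (dotC w). Qed.

Lemma dot_mulmx A u v : dot (A *m u) v = dot u (A^T *m v).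
Proof. by rewrite !dotE trmx_mul mulmxA. Qed.

Lemma sqnorm_ge0 v : 0 <= sqnorm v.
Proof. by apply: sumr_ge0 => i _; exact: sqr_ge0. Qed.

Lemma psdmx_dot A v : psdmx A -> 0 <= dot v (A *m v).
Proof. by move=> [_ /(_ v)]; rewrite dotE mulmxA. Qed.

End Dot.

Section SquareIntegrable.
Context {K : realType}.

Lemma lebesgue_aeW (P Q : set K) : P `<=` Q ->
  {ae @lebesgue_measure K, forall t, P t} -> {ae @lebesgue_measure K, forall t, Q t}.
Proof.
by move=> PQ H; exact: (@filterS _ _ (ae_filter_ringOfSetsType lebesgue_measure) _ _ PQ H).
Qed.

Lemma lebesgue_aeW2 (P Q R : set K) : (forall t, P t -> Q t -> R t) ->
  {ae @lebesgue_measure K, forall t, P t} -> {ae @lebesgue_measure K, forall t, Q t} ->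
  {ae @lebesgue_measure K, forall t, R t}.
Proof.
move=> PQR H H'.
exact: (@filterS2 _ _ (ae_filter_ringOfSetsType lebesgue_measure) _ _ _ PQR H H').
Qed.

Variable T : K.
Notation leb := (@lebesgue_measure K).
Implicit Types (f g h : K -> K).

Definition L1 h := leb.-integrable `[0, T] (EFin \o h).

Lemma L1_measurable h : L1 h -> measurable_fun `[0, T] h.
Proof. by move=> /measurable_int H; apply/measurable_EFinP. Qed.

Lemma L1D f g : L1 f -> L1 g -> L1 (fun t => f t + g t).
Proof. exact: integrableD_itv. Qed.

Lemma L1Z c f : L1 f -> L1 (fun t => c * f t).
Proof. exact: integrableZ_itv. Qed.

Lemma L1_sum (I : Type) (r : seq I) (h : I -> K -> K) :
  (forall i, L1 (h i)) -> L1 (fun t => \sum_(i <- r) h i t).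
Proof.
move=> ih; elim: r => [|i r IHr].
  by under eq_fun do rewrite big_nil; exact: (@integrable0 _ _ _ leb).
by under eq_fun do rewrite big_cons; exact: L1D.
Qed.

Lemma L1_le f h : measurable_fun `[0, T] f -> L1 h ->
  (forall t, `|f t| <= h t) -> L1 f.
Proof.
move=> mf ih fh; apply: le_integrable ih => //; first exact/measurable_EFinP.
by move=> t _ /=; rewrite lee_fin (le_trans (fh t))// ler_norm.
Qed.

Lemma L1_cst c : L1 (cst c).
Proof. by apply: within_itv_integrable; apply: continuous_subspaceT; exact: cst_continuous. Qed.

Definition sqint f := measurable_fun `[0, T] f /\ L1 (fun t => f t ^+ 2).

Lemma sqintM f g : sqint f -> sqint g -> L1 (fun t => f t * g t).
Proof.
move=> [mf if2] [mg ig2]; apply: L1_le (L1D if2 ig2) _.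
  exact: measurable_funM.
move=> t; rewrite ler_norml; apply/andP; split; have := sqr_ge0 (f t + g t);
  have := sqr_ge0 (f t - g t); nra.
Qed.

Lemma sqint_cst c : sqint (cst c).
Proof. by split=> //; exact: (L1_cst (c ^+ 2)). Qed.

Lemma sqint_L1 f : sqint f -> L1 f.
Proof.
by move=> sf; have := sqintM sf (sqint_cst 1); under eq_fun do rewrite mulr1.
Qed.

Lemma sqintD f g : sqint f -> sqint g -> sqint (fun t => f t + g t).
Proof.
move=> sf sg; split; first by apply: measurable_funD; [exact: sf.1|exact: sg.1].
under eq_fun do rewrite sqrrD.
apply: L1D; last exact: sg.2.
apply: L1D; first exact: sf.2.
under eq_fun do rewrite -mulr_natl.
exact/L1Z/sqintM.
Qed.

Lemma sqintZ c f : sqint f -> sqint (fun t => c * f t).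
Proof.
move=> sf; split; first by apply: measurable_funM => //; exact: sf.1.
by under eq_fun do rewrite exprMn; apply: L1Z; exact: sf.2.
Qed.

Lemma sqintM_continuous f g : {within `[0, T], continuous f} -> sqint g ->
  sqint (fun t => f t * g t).
Proof.
move=> cf [mg ig]; split.
  by apply: measurable_funM => //; exact: subspace_continuous_measurable_fun.
have cf2 : {within `[0, T], continuous (f \* f)}.
  by move=> x; apply: continuousM; exact: cf.
under eq_fun do rewrite exprMn [X in X * _]expr2.
exact: integrable_mul_continuous cf2 ig.
Qed.

Lemma sqint_sum (I : Type) (r : seq I) (h : I -> K -> K) :
  (forall i, sqint (h i)) -> sqint (fun t => \sum_(i <- r) h i t).
Proof.
move=> ih; elim: r => [|i r IHr].
  by under eq_fun do rewrite big_nil; exact: sqint_cst.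
by under eq_fun do rewrite big_cons; exact: sqintD.
Qed.

Lemma Rintegral_L1_sum (I : Type) (r : seq I) (h : I -> K -> K) :
  (forall i, L1 (h i)) ->
  \int[leb]_(t in `[0, T]) (\sum_(i <- r) h i t) =
  \sum_(i <- r) \int[leb]_(t in `[0, T]) h i t.
Proof.
move=> ih; elim: r => [|i r IHr].
  rewrite big_nil; under eq_Rintegral do rewrite big_nil.
  by rewrite Rintegral_cst// mul0r.
rewrite big_cons -IHr -RintegralD//; [|exact: ih|exact: L1_sum].
by apply: eq_Rintegral => t _; rewrite big_cons.
Qed.

Lemma Rintegral_ae f g : L1 f -> L1 g -> ae_eq leb `[0, T]%classic f g ->
  \int[leb]_(t in `[0, T]) f t = \int[leb]_(t in `[0, T]) g t.
Proof.
move=> /measurable_int mf /measurable_int mg fg; congr fine.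
by apply: ae_eq_integral => //; apply: filterS fg => t H Dt /=; rewrite H.
Qed.

End SquareIntegrable.

Section L2.
Context {K : realType}.
Variable T : K.
Notation leb := (@lebesgue_measure K).

Lemma L2P (n : nat) (f : K -> 'cV[K]_n) :
  L2 T f <-> forall i, sqint T (fun t => f t i ord0).
Proof.
have ge0 (g : K -> 'cV[K]_n) :
    (0 <= \int[leb]_(t in `[0%R, T]) (sqnorm (g t))%:E)%E.
  by apply: integral_ge0 => t _; rewrite lee_fin sqnorm_ge0.
split=> [[mf lf] i|H].
  split; first exact: mf.
  have ms : measurable_fun `[0, T] (fun t => sqnorm (f t)).
    by apply: measurable_sum => j; exact: measurable_funX.
  apply: (@L1_le _ _ _ (fun t => sqnorm (f t))).
  - exact: measurable_funX.
  - apply/integrableP; split; first exact/measurable_EFinP.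
    under eq_integral do rewrite /= ger0_norm ?sqnorm_ge0//.
    move: lf; rewrite /L2norm !ltey; apply: contraNN => /eqP ->//.
  - move=> t; rewrite ger0_norm ?sqr_ge0// /sqnorm (bigD1 i)//= lerDl.
    by apply: sumr_ge0 => j _; exact: sqr_ge0.
split; first by move=> i; exact: (H i).1.
have /integrableP[_] : L1 T (fun t => sqnorm (f t)).
  by apply: L1_sum => i; exact: (H i).2.
under eq_integral do rewrite /= ger0_norm ?sqnorm_ge0//.
by rewrite -!ge0_fin_numE ?sqrte_ge0//= sqrte_fin_num.
Qed.

Lemma L2D n (f g : K -> 'cV[K]_n) : L2 T f -> L2 T g -> L2 T (fun t => f t + g t).
Proof.
move=> /L2P Hf /L2P Hg; apply/L2P => i; under eq_fun do rewrite mxE.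
exact: sqintD.
Qed.

Lemma L2Z n c (f : K -> 'cV[K]_n) : L2 T f -> L2 T (fun t => c *: f t).
Proof.
by move=> /L2P Hf; apply/L2P => i; under eq_fun do rewrite mxE; exact: sqintZ.
Qed.

Lemma L2B n (f g : K -> 'cV[K]_n) : L2 T f -> L2 T g -> L2 T (fun t => f t - g t).
Proof.
move=> Hf Hg; have := L2D Hf (L2Z (-1) Hg).
by under eq_fun do rewrite scaleN1r.
Qed.

Lemma L2_mulop n p (A : 'M[K]_(p, n)) (f : K -> 'cV[K]_n) : L2 T f -> L2 T (mulop A f).
Proof.
move=> /L2P Hf; apply/L2P => i; rewrite /mulop; under eq_fun do rewrite mxE.
by apply: sqint_sum => j; exact: sqintZ.
Qed.

(** The factor exp(omega t) that undoes the weight is continuous on [0, T]; thereafter the iterates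
    are handled in plain L2. *)
Lemma L2w_L2 n omega (f : K -> 'cV[K]_n) : L2w T omega f -> L2 T f.
Proof.
move=> /L2P Hf; apply/L2P => i.
rewrite (_ : (fun t => _) = fun t => expR (omega * t) * (expR (- omega * t) *: f t) i ord0).
  apply: sqintM_continuous (Hf i); apply: continuous_subspaceT => t.
  apply: continuous_comp; last exact: continuous_expR.
  by apply: continuousM; [exact: cst_continuous|exact: cvg_id].
by apply/funext => t; rewrite mxE mulrA -expRD mulNr subrr expR0 mul1r.
Qed.

Lemma L1_dot n (f g : K -> 'cV[K]_n) : L2 T f -> L2 T g ->
  L1 T (fun t => dot (f t) (g t)).
Proof. by move=> /L2P Hf /L2P Hg; apply: L1_sum => i; exact: sqintM. Qed.

End L2.

(** * Weak derivatives and dissipation *)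

Section WeakDerivative.
Context {K : realType}.
Variable T : K.
Hypothesis T0 : 0 < T.
Notation leb := (@lebesgue_measure K).

Lemma test_function_continuous phi : test_function T phi ->
  continuous phi /\ continuous (phi^`())%classic.
Proof.
move=> [dphi _]; split=> t; apply: differentiable_continuous; apply/derivable1_diffP.
  exact: (dphi 0%N t).
exact: (dphi 1%N t).
Qed.

Lemma L1M_continuous f g : continuous f -> sqint T g -> L1 T (fun t => g t * f t).
Proof.
move=> cf sg; under eq_fun do rewrite mulrC.
apply: integrable_mul_continuous; last exact: sqint_L1.
exact: continuous_subspaceT.
Qed.

Lemma weak_derivative_mulop n p (A : 'M[K]_(p, n)) f g : L2 T f -> L2 T g ->
  is_weak_derivative T f g -> is_weak_derivative T (mulop A f) (mulop A g).
Proof.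
move=> /L2P Hf /L2P Hg fg phi tphi i.
have [cphi cphi'] := test_function_continuous tphi.
have E (h : K -> 'cV[K]_n) (psi : K -> K) : continuous psi ->
    (forall i, sqint T (fun t => h t i ord0)) ->
    \int[leb]_(t in `[0, T]) (mulop A h t i ord0 * psi t) =
    \sum_j A i j * \int[leb]_(t in `[0, T]) (h t j ord0 * psi t).
  move=> cpsi Hh; transitivity (\int[leb]_(t in `[0, T])
      (\sum_j A i j * (h t j ord0 * psi t))).
    apply: eq_Rintegral => t _; rewrite /mulop mxE mulr_suml.
    by apply: eq_bigr => j _; rewrite mulrA.
  have Lh j : L1 T (fun t => h t j ord0 * psi t) by exact: L1M_continuous.
  rewrite Rintegral_L1_sum; last by move=> j; exact: L1Z.
  by apply: eq_bigr => j _; rewrite RintegralZl//; exact: Lh.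
rewrite !E// -sumrN; apply: eq_bigr => j _.
by rewrite fg// mulrN.
Qed.

Lemma weak_derivativeB n (f g f' g' : K -> 'cV[K]_n) :
  L2 T f -> L2 T g -> L2 T f' -> L2 T g' ->
  is_weak_derivative T f f' -> is_weak_derivative T g g' ->
  is_weak_derivative T (fun t => f t - g t) (fun t => f' t - g' t).
Proof.
move=> /L2P Hf /L2P Hg /L2P Hf' /L2P Hg' ff' gg' phi tphi i.
have [cphi cphi'] := test_function_continuous tphi.
have E (h k : K -> 'cV[K]_n) (psi : K -> K) : continuous psi ->
    (forall i, sqint T (fun t => h t i ord0)) ->
    (forall i, sqint T (fun t => k t i ord0)) ->
    \int[leb]_(t in `[0, T]) ((h t - k t) i ord0 * psi t) =
    \int[leb]_(t in `[0, T]) (h t i ord0 * psi t) -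
    \int[leb]_(t in `[0, T]) (k t i ord0 * psi t).
  move=> cpsi Hh Hk.
  rewrite -RintegralB//; [|exact: L1M_continuous|exact: L1M_continuous].
  by apply: eq_Rintegral => t _; rewrite !mxE mulrBl.
by rewrite !E// ff'// gg'// opprB opprK addrC.
Qed.

Lemma aeq_cV n (f g : K -> 'cV[K]_n) :
  (forall i, ae_eq leb `[0, T]%classic (fun t => f t i ord0) (fun t => g t i ord0)) ->
  aeq T f g.
Proof.
move=> fg; have := @filter_forall _ _ _ _ (ae_filter_ringOfSetsType leb) fg.
apply: lebesgue_aeW => t H Dt; apply/matrixP => i j.
by rewrite ord1; exact: H.
Qed.

(** g - h is a weak derivative of f - f = 0, whose continuous representative is 0; hence every
    integral of g - h over [0, t] vanishes. *)
Lemma weak_derivative_unique n (f g h : K -> 'cV[K]_n) :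
  L2 T f -> L2 T g -> L2 T h ->
  is_weak_derivative T f g -> is_weak_derivative T f h -> aeq T g h.
Proof.
move=> Lf Lg Lh fg fh; apply: aeq_cV => i.
have sgh : sqint T (fun t => (g t - h t) i ord0) by have /L2P := L2B Lg Lh; exact.
have wgh := weak_derivativeB Lf Lf Lg Lh fg fh.
have H0 : ae_eq leb `[0, T]%classic (fun t => (g t - h t) i ord0) (cst 0).
  apply: ae_eq0_of_primitive; first exact: sqint_L1.
  have c0 : {within `[0, T], continuous (cst 0 : K -> K)}.
    by apply: continuous_subspaceT; exact: cst_continuous.
  have m0 : measurable_fun `[0, T] (cst 0 : K -> K) by exact: measurable_cst.
  have e0 : ae_eq leb `[0, T]%classic (cst 0 : K -> K) (cst 0) by exact: ae_eq_refl.
  have w0 phi : test_function T phi ->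
      \int[leb]_(t in `[0, T]) (cst 0 t * (phi^`())%classic t) =
      - \int[leb]_(t in `[0, T]) ((g t - h t) i ord0 * phi t).
    move=> tphi; have := wgh phi tphi i => <-; apply: eq_Rintegral => t _.
    by rewrite subrr mxE.
  move=> t t0T; have := weak_FTC T0 c0 e0 m0 (sqint_L1 sgh) w0 t0T.
  by rewrite /= add0r.
apply: lebesgue_aeW H0 => t H /H /=.
by rewrite !mxE => /eqP; rewrite subr_eq0 => /eqP.
Qed.

Definition vprimitive n (g G : K -> 'cV[K]_n) :=
  forall i, primitive_on T (fun t => g t i ord0) (fun t => G t i ord0).

Lemma weak_derivative_primitive n (f g : K -> 'cV[K]_n) c : L2 T f -> L2 T g ->
  is_weak_derivative T f g -> has_value T f 0 c ->
  exists F, [/\ aeq T f F, vprimitive g F & F 0 = c].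
Proof.
move=> /L2P Hf /L2P Hg fg [F [cF fF F0]]; exists F; split=> // i.
split; first exact: sqint_L1.
have fFi : ae_eq leb `[0, T]%classic (fun t => f t i ord0) (fun t => F t i ord0).
  by apply: lebesgue_aeW fF => t H Dt /=; rewrite (H Dt).
apply: (weak_FTC T0 (cF i) fFi (Hf i).1); first exact: sqint_L1.
by move=> phi tphi; exact: fg.
Qed.

Lemma primitive_onD a b A B : primitive_on T a A -> primitive_on T b B ->
  primitive_on T (fun t => a t + b t) (fun t => A t + B t).
Proof.
move=> [ia HA] [ib HB]; split; first exact: L1D.
move=> t t0T; rewrite (HA _ t0T) (HB _ t0T) RintegralD//; first by ring.
  by apply: integrableS ia => //; apply: subset_itvl; rewrite bnd_simp; case/andP: t0T.
by apply: integrableS ib => //; apply: subset_itvl; rewrite bnd_simp; case/andP: t0T.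
Qed.

Lemma primitive_onZ c a A : primitive_on T a A ->
  primitive_on T (fun t => c * a t) (fun t => c * A t).
Proof.
move=> [ia HA]; split; first exact: L1Z.
move=> t t0T; rewrite (HA _ t0T) RintegralZl//; first by rewrite mulrDr.
by apply: integrableS ia => //; apply: subset_itvl; rewrite bnd_simp; case/andP: t0T.
Qed.

Lemma primitive_on_sum (I : Type) (r : seq I) (a A : I -> K -> K) :
  (forall i, primitive_on T (a i) (A i)) ->
  primitive_on T (fun t => \sum_(i <- r) a i t) (fun t => \sum_(i <- r) A i t).
Proof.
move=> aA; elim: r => [|i r IHr].
  under eq_fun do rewrite big_nil; under [X in primitive_on _ _ X]eq_fun do rewrite big_nil.
  split; first exact: (@integrable0 _ _ _ leb).
  by move=> t _; rewrite Rintegral_cst// mul0r addr0.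
under eq_fun do rewrite big_cons; under [X in primitive_on _ _ X]eq_fun do rewrite big_cons.
exact: primitive_onD.
Qed.

Lemma vprimitive_mulop n p (A : 'M[K]_(p, n)) g G :
  vprimitive g G -> vprimitive (mulop A g) (mulop A G).
Proof.
move=> gG i; rewrite /mulop.
under eq_fun do rewrite mxE; under [X in primitive_on _ _ X]eq_fun do rewrite mxE.
by apply: primitive_on_sum => j; exact: primitive_onZ.
Qed.

Lemma vprimitive_dot n (f g F G : K -> 'cV[K]_n) :
  vprimitive f F -> vprimitive g G ->
  primitive_on T (fun t => dot (f t) (G t) + dot (F t) (g t)) (fun t => dot (F t) (G t)).
Proof.
move=> fF gG; rewrite /dot; under eq_fun do rewrite -big_split/=.
by apply: primitive_on_sum => i; apply: primitive_onM => //; exact: ltW.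
Qed.

End WeakDerivative.

(** * Exponentially weighted integrals *)

Section Weight.
Context {K : realType}.
Variables (T W : K).
Hypotheses (T0 : 0 < T) (W0 : 0 <= W).
Notation leb := (@lebesgue_measure K).

Definition weight (t : K) := expR (- (2 * W) * t).

Lemma is_derive_weight (t : K) : is_derive t 1 weight (- (2 * W) * weight t).
Proof.
have := @is_derive1_comp _ expR _ t _ _ (is_derive_expR _)
  (is_derive_affine (- (2 * W)) 0 t).
rewrite (_ : _ \o _ = weight) ?addr0; last first.
  by apply/funext => s; rewrite /weight /= addr0.
by rewrite mulrC.
Qed.

Lemma continuous_weight : continuous weight.
Proof.
move=> t; apply: differentiable_continuous; apply/derivable1_diffP.
by case: (is_derive_weight t).
Qed.

Lemma primitive_weight : primitive_on T (fun t => - (2 * W) * weight t) weight.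
Proof.
have cw' : continuous (fun t => - (2 * W) * weight t).
  by move=> t; apply: cvgM; [exact: cvg_cst|exact: continuous_weight].
split; first by apply: within_itv_integrable; exact: continuous_subspaceT.
move=> t /andP[]; rewrite le_eqVlt => /predU1P[<- _|t0 tT].
  by rewrite set_itv1 Rintegral_set1 addr0.
rewrite /Rintegral (@continuous_FTC2 _ _ weight)//=; first by rewrite subrKC.
- exact: continuous_subspaceT.
- split; first by move=> x _; case: (is_derive_weight x).
  + exact/cvg_at_right_filter/continuous_weight.
  + exact/cvg_at_left_filter/continuous_weight.
- by move=> x _; rewrite derive1E; case: (is_derive_weight x).
Qed.

Definition wint (h : K -> K) := \int[leb]_(t in `[0, T]) (weight t * h t).

Lemma L1_weight h : L1 T h -> L1 T (fun t => weight t * h t).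
Proof.
move=> ih; apply: integrable_mul_continuous ih.
by apply: continuous_subspaceT; exact: continuous_weight.
Qed.

Lemma wintD f g : L1 T f -> L1 T g -> wint (fun t => f t + g t) = wint f + wint g.
Proof.
move=> i1 i2; rewrite /wint -RintegralD//; [|exact: L1_weight..].
by apply: eq_Rintegral => t _; rewrite mulrDr.
Qed.

Lemma wintZ c f : L1 T f -> wint (fun t => c * f t) = c * wint f.
Proof.
move=> i1; rewrite /wint -RintegralZl//; last exact: L1_weight.
by apply: eq_Rintegral => t _; rewrite mulrCA.
Qed.

Lemma wint_ae f g : L1 T f -> L1 T g -> ae_eq leb `[0, T]%classic f g ->
  wint f = wint g.
Proof.
move=> i1 i2 fg; apply: Rintegral_ae; [exact: L1_weight..|].
by apply: lebesgue_aeW fg => t H Dt /=; rewrite (H Dt).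
Qed.

Lemma le_wint f g : L1 T f -> L1 T g -> (forall t, f t <= g t) -> wint f <= wint g.
Proof.
move=> i1 i2 fg; apply: le_Rintegral => //; [exact: L1_weight..|].
by move=> t _; rewrite ler_wpM2l ?expR_ge0.
Qed.

Lemma wint_ge0 f : (forall t, 0 <= f t) -> 0 <= wint f.
Proof. by move=> f0; apply: Rintegral_ge0 => t _; rewrite mulr_ge0 ?expR_ge0. Qed.

(** On [0, T] the weight is at least exp(-2 W T), so decay of weighted integrals gives decay of
    plain ones. *)
Lemma Rintegral_le_wint f : L1 T f -> (forall t, 0 <= f t) ->
  \int[leb]_(t in `[0, T]) f t <= expR (2 * W * T) * wint f.
Proof.
move=> i1 f0; rewrite -RintegralZl//; last exact: L1_weight.
apply: le_Rintegral => //; first exact/L1Z/L1_weight.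
move=> t; rewrite /= in_itv/= => /andP[t0 tT].
rewrite mulrA -expRD ler_peMl// -[leLHS]expR0 ler_expR mulNr subr_ge0.
by rewrite ler_wpM2l// mulr_ge0.
Qed.

(* For [S] symmetric with [P S P = P], [d^T P d] is the quadratic form [F^T S F]
   in the absolutely continuous representative [F] of [P d]. *)
Lemma weighted_dissipation n (P : 'M[K]_n) (d g : K -> 'cV[K]_n) :
  psdmx P -> L2 T d -> L2 T g -> is_weak_derivative T (mulop P d) g ->
  has_value T (mulop P d) 0 0 ->
  W * wint (fun t => dot (d t) (P *m d t)) <= wint (fun t => dot (g t) (d t)).
Proof.
move=> Ppsd Ld Lg wd hv; have PT := Ppsd.1.
have [S ST PSP] : exists2 S : 'M[K]_n, S^T = S & P *m S *m P = P.
  (* [pinvmx P] need not be symmetric; since P is, its transpose is a generalized inverse as well,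
     and S is the mean of the two. *)
  have PVP : P *m pinvmx P *m P = P by rewrite mulmxKpV.
  have PVTP : P *m (pinvmx P)^T *m P = P.
    by have := congr1 trmx PVP; rewrite !trmx_mul PT mulmxA.
  exists (2^-1 *: (pinvmx P + (pinvmx P)^T)).
    rewrite linearZ/= linearD/= trmxK. by rewrite addrC.
  rewrite -scalemxAr mulmxDr -scalemxAl mulmxDl PVP PVTP.
  by rewrite -mulr2n -[P *+ 2]scaler_nat scalerA mulVf ?scale1r.
have LPd := L2_mulop P Ld.
have [F [PdF gF F0]] := weak_derivative_primitive T0 LPd Lg wd hv.
(* P S fixes P d, so P S g is another weak derivative of P d. *)
have gPSg : aeq T g (mulop (P *m S) g).
  apply: (weak_derivative_unique T0 LPd Lg (L2_mulop _ Lg) wd).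
  have := weak_derivative_mulop (P *m S) LPd Lg wd.
  rewrite (_ : mulop _ (mulop P d) = mulop P d)//.
  by apply/funext => t; rewrite /mulop mulmxA PSP.
have pF := vprimitive_mulop S gF.
set q := fun t => dot (F t) (S *m F t).
set q' := fun t => dot (g t) (S *m F t) + dot (F t) (S *m g t).
have pq : primitive_on T q' q by exact: vprimitive_dot.
have TT : 0 <= T <= T by rewrite lexx ltW.
have qT : 0 <= q T.
  (* F equals P d only almost everywhere, so membership of F T in the range of P comes from
     integrating g = P S g from F 0 = 0. Then q T = (S F T)^T P (S F T) >= 0. *)
  have FT : F T = P *m S *m F T.
    apply/matrixP => i j; rewrite ord1 (gF i).2//.
    have -> : (P *m S *m F T) i ord0 = mulop (P *m S) F T i ord0 by [].
    rewrite (vprimitive_mulop (P *m S) gF i).2//.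
    rewrite /mulop F0 mulmx0; congr (_ + _).
    apply: Rintegral_ae; [exact: (gF i).1|exact: (vprimitive_mulop (P *m S) gF i).1|].
    apply: lebesgue_aeW gPSg => t H Dt.
    exact: (congr1 (fun v : 'cV[K]_n => v i ord0) (H Dt)).
  by rewrite /q {1}FT -mulmxA dotC; apply: psdmx_dot.
have [_ /(_ T)] := primitive_onM (ltW T0) primitive_weight pq.
move=> /(_ TT).
have q0 : q 0 = 0 by rewrite /q F0 mulmx0 /dot big1// => i _; rewrite mxE mul0r.
rewrite q0 mulr0 add0r => E.
have [iq' _] := pq; have iq : L1 T q.
  by apply: within_itv_integrable; exact: primitive_on_continuous (ltW T0) pq.
have {}E : wint q' = weight T * q T + 2 * (W * wint q).
  rewrite E; transitivity (\int[leb]_(t in `[0, T])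
      (- (2 * W) * (weight t * q t) + weight t * q' t) + 2 * (W * wint q)).
    rewrite RintegralD//; [|exact/L1Z/L1_weight|exact: L1_weight].
    by rewrite RintegralZl//; [rewrite /wint; ring|exact: L1_weight].
  by congr (_ + _); apply: eq_Rintegral => t _; ring.
have iPd := L1_dot Ld LPd; have igd := L1_dot Lg Ld.
have -> : wint (fun t => dot (d t) (P *m d t)) = wint q.
  apply: wint_ae => //; apply: lebesgue_aeW PdF => t H Dt.
  by rewrite /q -(H Dt) /mulop dot_mulmx PT -{1}PSP -!mulmxA.
(* Almost everywhere F = P d, so q' = 2 (S P d)^T g = 2 d^T (P S g) = 2 d^T g. *)
have E2 : wint q' = 2 * wint (fun t => dot (g t) (d t)).
  rewrite -wintZ//; apply: wint_ae => //; first exact: L1Z.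
  apply: lebesgue_aeW2 PdF gPSg => t HF Hg Dt.
  rewrite /q' -(HF Dt) [dot (P *m _) _]dotC dot_mulmx ST -mulr2n mulr_natl.
  congr (_ *+ 2); rewrite [in RHS](Hg Dt) /mulop -mulmxA dot_mulmx PT.
  by rewrite dot_mulmx ST.
have := wint_ge0 (f := cst 0).
have : 0 <= weight T * q T by rewrite mulr_ge0 ?expR_ge0.
by move: E; rewrite E2; lra.
Qed.

End Weight.

(** * Positive semidefinite matrices *)

Section PositiveSemidefinite.
Context {K : realType}.

Lemma psdmxD n (A B : 'M[K]_n) : psdmx A -> psdmx B -> psdmx (A + B).
Proof.
move=> [AT A0] [BT B0]; split; first by rewrite linearD/= AT BT.
by move=> v; rewrite mulmxDr mulmxDl mxE addr_ge0.
Qed.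

Lemma psdmxZ n c (A : 'M[K]_n) : 0 <= c -> psdmx A -> psdmx (c *: A).
Proof.
move=> c0 [AT A0]; split; first by rewrite linearZ/= AT.
by move=> v; rewrite -scalemxAr -scalemxAl mxE mulr_ge0.
Qed.

Lemma psdmx1 n : psdmx (1%:M : 'M[K]_n).
Proof.
split; first exact: trmx1.
by move=> v; rewrite mulmx1 -dotE -sqnormE sqnorm_ge0.
Qed.

Lemma psdmx_cauchy_schwarz n (A : 'M[K]_n) u v : psdmx A ->
  dot u (A *m v) ^+ 2 <= dot u (A *m u) * dot v (A *m v).
Proof.
move=> Apsd; have AT := Apsd.1.
set a := dot v _; set b := dot u _; set c := dot u (A *m u).
have H s : 0 <= a + 2 * s * b + s ^+ 2 * c.
  have := psdmx_dot (v + s *: u) Apsd.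
  rewrite mulmxDr -scalemxAr !dotDl !dotDr !dotZl !dotZr.
  rewrite [dot v (A *m u)]dotC dot_mulmx AT -/a -/b -/c; congr (0 <= _); ring.
have c0 : 0 <= c by exact: psdmx_dot.
move: c0; rewrite le_eqVlt => /predU1P[c0|c0].
  have [->|b0] := eqVneq b 0; first by rewrite -c0 mul0r expr0n.
  (* With c = 0 the polynomial in [H] is affine in s; for nonzero b this choice of s gives it the
     value -1. *)
  have := H (- (a + 1) / (2 * b)); rewrite -c0 mulr0 addr0.
  have -> : 2 * (- (a + 1) / (2 * b)) * b = - (a + 1) by field.
  by rewrite opprD addrA subrr add0r ler0N1.
have := H (- b / c).
have -> : a + 2 * (- b / c) * b + (- b / c) ^+ 2 * c = a - b ^+ 2 / c.
  by field; rewrite gt_eqF.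
by rewrite subr_ge0 ler_pdivrMr// mulrC.
Qed.

Lemma dot_cauchy_schwarz n (u v : 'cV[K]_n) : dot u v ^+ 2 <= sqnorm u * sqnorm v.
Proof.
by have := psdmx_cauchy_schwarz u v (psdmx1 n); rewrite !mul1mx !sqnormE.
Qed.

(** Cauchy-Schwarz row by row; the constant is the squared Frobenius norm. *)
Lemma sqnorm_mulmx_le n p (A : 'M[K]_(p, n)) : exists2 C, 0 <= C &
  forall v, sqnorm (A *m v) <= C * sqnorm v.
Proof.
exists (\sum_i sqnorm (row i A)^T); first by apply: sumr_ge0 => i _; exact: sqnorm_ge0.
move=> v; rewrite mulr_suml; apply: ler_sum => i _.
rewrite (_ : (A *m v) i ord0 = dot (row i A)^T v) ?dot_cauchy_schwarz//.
by rewrite mxE; apply: eq_bigr => j _; rewrite !mxE.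
Qed.

(** Cauchy-Schwarz for the form of A bounds the square of the entry e_i^T A v by (e_i^T A e_i)(v^T A
    v); the constant is the trace of A. In particular v^T A v = 0 forces A v = 0. *)
Lemma psdmx_sqnorm_le n (A : 'M[K]_n) : psdmx A -> exists2 C, 0 <= C &
  forall v, sqnorm (A *m v) <= C * dot v (A *m v).
Proof.
move=> Apsd; pose e i : 'cV[K]_n := delta_mx i ord0.
exists (\sum_i dot (e i) (A *m e i)).
  by apply: sumr_ge0 => i _; exact: psdmx_dot.
move=> v; rewrite mulr_suml; apply: ler_sum => i _.
rewrite (_ : (A *m v) i ord0 = dot (e i) (A *m v)) ?psdmx_cauchy_schwarz//.
rewrite /dot (bigD1 i)//= big1 ?addr0 => [|j ji]; first by rewrite [e i i _]mxE !eqxx mul1r.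
by rewrite [e i j _]mxE (negbTE ji) mul0r.
Qed.

Lemma sqnorm_eq0 n (v : 'cV[K]_n) : sqnorm v <= 0 -> v = 0.
Proof.
move=> v0; have {v0} /eqP : sqnorm v = 0 by apply/eqP; rewrite eq_le v0 sqnorm_ge0.
rewrite psumr_eq0 => [/allP H|i _]; last exact: sqr_ge0.
apply/matrixP => i j; rewrite ord1 mxE; apply/eqP.
by have := H i (mem_index_enum i); rewrite /= sqrf_eq0.
Qed.

(** In place of a smallest eigenvalue: |v|^2 = |A^-1 A v|^2 <= C1 |A v|^2 <= C1 C2 v^T A v. Adding 1
    makes the constant invertible, as C1 and C2 are only known to be nonnegative. *)
Lemma psdmx_unit_coercive n (A : 'M[K]_n) : psdmx A -> A \in unitmx ->
  exists2 c, 0 < c & forall v, c * sqnorm v <= dot v (A *m v).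
Proof.
move=> Apsd uA; have [C1 C10 H1] := sqnorm_mulmx_le (invmx A).
have [C2 C20 H2] := psdmx_sqnorm_le Apsd.
have C0 : 0 < C1 * C2 + 1 by rewrite ltr_wpDl// mulr_ge0.
exists (C1 * C2 + 1)^-1; first by rewrite invr_gt0.
move=> v; rewrite ler_pdivrMl//.
have := H1 (A *m v); rewrite mulKmx// => /le_trans; apply.
rewrite mulrDl mul1r ler_wpDr//; first exact: psdmx_dot.
by rewrite -mulrA ler_wpM2l.
Qed.

(** If y annihilates A + B, the two nonnegative forms add up to 0 at y, so both vanish there, and y
    lies in both kernels. *)
Lemma psdmxD_unit n (A B : 'M[K]_n) : psdmx A -> psdmx B ->
  (forall y : 'rV_n, y *m A = 0 -> y *m B = 0 -> y = 0) -> A + B \in unitmx.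
Proof.
move=> Apsd Bpsd H; rewrite -row_free_unit -kermx_eq0; apply/rowV0P => y.
move=> /sub_kermxP yAB.
have : dot y^T ((A + B) *m y^T) = 0.
  by rewrite dotE trmxK mulmxA yAB mul0mx mxE.
rewrite mulmxDl dotDr => /eqP.
rewrite paddr_eq0 ?psdmx_dot// => /andP[/eqP qA /eqP qB].
have ker (D : 'M[K]_n) : psdmx D -> dot y^T (D *m y^T) = 0 -> y *m D = 0.
  move=> Dpsd qD; have [C _ /(_ y^T)] := psdmx_sqnorm_le Dpsd.
  rewrite qD mulr0 => /sqnorm_eq0 /(congr1 trmx).
  by rewrite trmx_mul trmxK Dpsd.1 trmx0.
by apply: H; exact: ker.
Qed.

Lemma row_free_row_mx n p q (A : 'M[K]_(n, p)) (B : 'M[K]_(n, q)) (y : 'rV_n) :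
  \rank (row_mx A B) = n -> y *m A = 0 -> y *m B = 0 -> y = 0.
Proof.
move=> rAB yA yB; apply/eqP.
have fAB : row_free (row_mx A B) by rewrite /row_free rAB.
by rewrite -(mulmx_free_eq0 _ fAB) mul_mx_row yA yB row_mx0.
Qed.

(** A common left null vector of a P and b R also annihilates a P Q, and full rank excludes it. In
    the application P Q is E. *)
Lemma coercive_of_rank n (P R Q : 'M[K]_n) (a b : K) : psdmx P -> psdmx R ->
  0 <= a -> 0 <= b -> \rank (row_mx (a *: (P *m Q)) (b *: R)) = n ->
  exists2 c, 0 < c & forall v, c * sqnorm v <= a * dot v (P *m v) + b * dot v (R *m v).
Proof.
move=> Ppsd Rpsd a0 b0 rk.
have aP := psdmxZ a0 Ppsd; have bR := psdmxZ b0 Rpsd.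
have U : a *: P + b *: R \in unitmx.
  apply: psdmxD_unit => // y yP yR; apply: row_free_row_mx rk _ yR.
  by rewrite scalemxAl mulmxA yP mul0mx.
have [c c0 H] := psdmx_unit_coercive (psdmxD aP bR) U.
exists c => // v; have := H v.
by rewrite mulmxDl -!scalemxAl dotDr !dotZr.
Qed.

(** E Q^-1 = Q^-T (Q^T E) Q^-1 is congruent to E^T Q = Q^T E. *)
Lemma psdmx_mul_invmx n (E Q : 'M[K]_n) : E^T *m Q = Q^T *m E -> psdmx (E^T *m Q) ->
  Q \in unitmx -> psdmx (E *m invmx Q).
Proof.
move=> EQ [_ psd] uQ; have uQT : Q^T \in unitmx by rewrite unitmx_tr.
have PT : (E *m invmx Q)^T = E *m invmx Q.
  rewrite trmx_mul trmx_inv; apply: (canRL (mulmxK uQ)).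
  by rewrite -mulmxA EQ mulKmx.
split=> // v; have := psd (invmx Q *m v).
by rewrite trmx_mul trmx_inv EQ !mulmxA mulmxKV.
Qed.

Lemma psdmx_mxdiag s (p : 'I_s -> nat) (A_ : forall i, 'M[K]_(p i)) :
  (forall i, psdmx (A_ i)) -> psdmx (\mxdiag_i A_ i).
Proof.
move=> psd; split; first by rewrite tr_mxdiag; apply: eq_mxdiag => i; exact: (psd i).1.
move=> v; rewrite -[v]submxcolK tr_mxcol mul_mxrow_mxdiag mul_mxrow_mxcol summxE.
by apply: sumr_ge0 => i _; exact: (psd i).2.
Qed.

Lemma mul_mxdiag s (p : 'I_s -> nat) (A_ B_ : forall i, 'M[K]_(p i)) :
  \mxdiag_i A_ i *m \mxdiag_i B_ i = \mxdiag_i (A_ i *m B_ i).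
Proof.
rewrite [X in _ *m X]/mxdiag mul_mxdiag_mxblock; apply/eq_mxblock => i j.
by case: eqVneq => [->|]; rewrite ?conform_mx_id ?mulmx0.
Qed.

Lemma unitmx_mxdiag s (p : 'I_s -> nat) (A_ : forall i, 'M[K]_(p i)) :
  (forall i, A_ i \in unitmx) -> \mxdiag_i A_ i \in unitmx.
Proof.
move=> uA; have : (\mxdiag_i invmx (A_ i)) *m \mxdiag_i A_ i = 1%:M.
  rewrite mul_mxdiag -(mxdiagZ (p_ := p)); apply: eq_mxdiag => i.
  by rewrite mulVmx.
by move/mulmx1_unit => [].
Qed.

Lemma ph_blocks_global s (p : 'I_s -> nat)
  (E_ : forall i, 'M[K]_(p i)) (J_ : forall i j, 'M[K]_(p i, p j))
  (R_ Q_ : forall i, 'M[K]_(p i)) : ph_blocks E_ J_ R_ Q_ ->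
  [/\ psdmx (\mxdiag_i R_ i), (\mxblock_(i, j) J_ i j)^T = - \mxblock_(i, j) J_ i j,
      (\mxdiag_i J_ i i)^T = - \mxdiag_i J_ i i,
      psdmx (\mxdiag_i E_ i *m invmx (\mxdiag_i Q_ i)) & \mxdiag_i Q_ i \in unitmx].
Proof.
move=> [Rpsd JdT JT EQ uQ]; have uQd := unitmx_mxdiag uQ.
split=> //; first exact: psdmx_mxdiag.
- rewrite tr_mxblock -mxblockN; apply/eq_mxblock => i j.
  have [ij|ji|/ord_inj ->] := ltngtP i j; last exact: JdT.
    by rewrite (JT _ _ ij) linearN/= trmxK.
  by rewrite (JT _ _ ji) opprK.
- by rewrite tr_mxdiag -mxdiagN; apply: eq_mxdiag => i; exact: JdT.
- apply: psdmx_mul_invmx => //; rewrite !tr_mxdiag !mul_mxdiag.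
    by apply: eq_mxdiag => i; exact: (EQ i).1.
  by apply: psdmx_mxdiag => i; exact: (EQ i).2.
Qed.

Lemma dot_skew n (A : 'M[K]_n) v : A^T = - A -> dot v (A *m v) = 0.
Proof.
move=> AT; have : dot v (A *m v) = - dot v (A *m v).
  by rewrite {1}dotC dot_mulmx AT mulNmx dotNr.
lra.
Qed.

End PositiveSemidefinite.

(** * Convergence of the iteration *)

Section Convergence.
Context {K : realType}.
Variable T : K.
Hypothesis T0 : 0 < T.
Notation leb := (@lebesgue_measure K).

(** The energy a decreases and is bounded below, so its increments tend to 0; they dominate c e. *)
Lemma dissipation_cvg0 (c : K) (a e : nat -> K) : 0 < c ->
  (forall k, 0 <= a k) -> (forall k, 0 <= e k) ->
  (forall k, a k.+1 <= a k - c * e k) -> e k @[k --> \oo] --> 0.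
Proof.
move=> c0 a0 e0 ae.
have ca : cvgn a.
  apply: nonincreasing_is_cvgn; last by exists 0 => _ [k _ <-].
  apply/nonincreasing_seqP => k; rewrite (le_trans (ae k))// gerBl mulr_ge0//.
  exact: ltW.
have ca1 : a k.+1 @[k --> \oo] --> limn a.
  by have := ca; rewrite -(cvg_shiftS a).
have cd : c^-1 * (a k - a k.+1) @[k --> \oo] --> (0 : K).
  rewrite -[0](mulr0 c^-1); apply: cvgM; first exact: cvg_cst.
  by rewrite -[X in _ --> X](subrr (limn a)); apply: cvgB ca ca1.
apply: (squeeze_cvgr _ (cvg_cst 0) cd); near=> k.
by rewrite e0/= ler_pdivlMl// lerBrDr addrC -lerBrDr ae.
Unshelve. all: by end_near. Qed.

Lemma cvg_sqrt0 (r : nat -> K) : r k @[k --> \oo] --> 0 ->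
  (Num.sqrt (r k))%:E @[k --> \oo] --> 0%E.
Proof.
move=> r0; apply: cvg_EFin; first exact: nearW.
rewrite -[0]sqrtr0; apply: continuous_cvg r0.
exact: sqrt_continuous.
Qed.

Lemma squeeze0 (c : K) (r e : nat -> K) : (forall k, 0 <= r k) ->
  (forall k, r k <= c * e k) -> e k @[k --> \oo] --> 0 -> r k @[k --> \oo] --> 0.
Proof.
move=> r0 re e0; have ce : c * e k @[k --> \oo] --> 0.
  by rewrite -[0](mulr0 c); apply: cvgM => //; exact: cvg_cst.
apply: (squeeze_cvgr _ (cvg_cst 0) ce); near=> k.
by rewrite r0 re.
Unshelve. all: by end_near. Qed.

Lemma L1_sqnorm n (f : K -> 'cV[K]_n) : L2 T f -> L1 T (fun t => sqnorm (f t)).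
Proof.
move=> Lf; rewrite (_ : (fun t => _) = fun t => dot (f t) (f t)); first exact: L1_dot.
by apply/funext => t; rewrite sqnormE.
Qed.

Lemma integral_sqnorm n (f : K -> 'cV[K]_n) : L2 T f ->
  (\int[leb]_(t in `[0%R, T]) (sqnorm (f t))%:E)%E =
  (\int[leb]_(t in `[0, T]) sqnorm (f t))%:E.
Proof.
by move=> Lf; rewrite fineK//; apply: integrable_fin_num => //; exact: L1_sqnorm.
Qed.

Lemma cvg_Rintegral_sqnorm n (W c : K) (f : nat -> K -> 'cV[K]_n) (e : nat -> K) :
  0 <= W -> (forall k, L2 T (f k)) ->
  (forall k, wint T W (fun t => sqnorm (f k t)) <= c * e k) ->
  e k @[k --> \oo] --> 0 ->
  \int[leb]_(t in `[0, T]) sqnorm (f k t) @[k --> \oo] --> 0.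
Proof.
move=> W0 Lf fe e0; apply: (squeeze0 (c := expR (2 * W * T) * c) _ _ e0) => k.
  by apply: Rintegral_ge0 => t _; exact: sqnorm_ge0.
rewrite (le_trans (Rintegral_le_wint W0 (L1_sqnorm (Lf k)) _))//.
  by move=> t; exact: sqnorm_ge0.
by rewrite -[leRHS]mulrA ler_wpM2l ?expR_ge0.
Qed.

Lemma H1_wderiv n (f : K -> 'cV[K]_n) : H1 T f ->
  L2 T (wderiv T f) /\ is_weak_derivative T f (wderiv T f).
Proof.
by move=> [_ ex]; have := @xgetPex _ (fun=> 0) [set g | L2 T g /\ is_weak_derivative T f g] ex.
Qed.

End Convergence.

(** * The error recursion and its energy identity *)

Section PeacemanRachford.
Context {K : realType} (T : K) {n m : nat}.
Variables (E Jd J R Q : 'M[K]_n) (B : 'M[K]_(n, m)).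
Variables (u : K -> 'cV[K]_m) (x0 : 'cV[K]_n).
Variables (lambda alpha mu omega : K).
Variables (xs : nat -> K -> 'cV[K]_n) (x : K -> 'cV[K]_n).
Local Notation P := (E *m invmx Q).
Local Notation leb := (@lebesgue_measure K).
Hypothesis T0 : 0 < T.
Hypothesis Rpsd : psdmx R.
Hypothesis JT : J^T = - J.
Hypothesis JdT : Jd^T = - Jd.
Hypothesis Ppsd : psdmx P.
Hypothesis uQ : Q \in unitmx.
Hypothesis lambda0 : 0 < lambda.
Hypothesis alpha01 : 0 <= alpha <= 1.
Hypothesis mu0 : 0 <= mu.
Hypothesis hxs0 : domM T E x0 omega (xs 0%N).
Hypothesis hxs : forall k, iteration_step T E Jd J R Q B u x0 lambda alpha mu omega
                     (xs k) (xs k.+1).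
Hypothesis hx : weak_solution T E J R Q B u x0 x.

(* Any weight exceeding [mu] makes the form of [M] dominate that of [E Q^-1];
   [omega] itself may equal [mu], but the recursion does not depend on it. *)
Let W := mu + 1.
Let W0 : 0 <= W. Proof. by rewrite addr_ge0. Qed.

Let opMx := opM T E Jd R Q B u alpha mu.
Let A1 := Jd - alpha *: R + mu *: P.
Let N := (1 - alpha) *: R + mu *: P - (J - Jd).
Let d k t := Q *m (xs k t - x t).
(** The difference of the two chosen weak derivatives, not the one chosen for the difference: this
    makes [opM_xs] an identity at every t. *)
Let D k t := wderiv T (mulop E (xs k)) t - wderiv T (mulop E x) t.
Let Md k t := D k t - A1 *m d k t.
Let z k t := d k t + lambda *: Md k t.

Let mulop_invK f : mulop (invmx Q) (mulop Q f) = f.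
Proof. by apply/funext => t; rewrite /mulop mulKmx. Qed.

Let domM_xs k : domM T E x0 omega (xs k).
Proof.
case: k => [//|k]; have [v [y [_ [[x' dx' <-] _] ->]]] := hxs k.
by rewrite mulop_invK.
Qed.

Let L2_xs k : L2 T (xs k).
Proof. by case: (domM_xs k) => /L2w_L2. Qed.

Let L2_x : L2 T x. Proof. by case: hx. Qed.

Let L2_d k : L2 T (d k).
Proof. exact: L2_mulop (L2B (L2_xs k) L2_x). Qed.

Let wderiv_xs k : L2 T (wderiv T (mulop E (xs k))) /\
  is_weak_derivative T (mulop E (xs k)) (wderiv T (mulop E (xs k))).
Proof. by apply: H1_wderiv; case: (domM_xs k). Qed.

Let wderiv_x : L2 T (wderiv T (mulop E x)) /\
  is_weak_derivative T (mulop E x) (wderiv T (mulop E x)).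
Proof. by apply: H1_wderiv; case: hx. Qed.

Let L2_D k : L2 T (D k).
Proof. exact: L2B (wderiv_xs k).1 wderiv_x.1. Qed.

Let L2_Md k : L2 T (Md k).
Proof. exact: L2B (L2_D k) (L2_mulop A1 (L2_d k)). Qed.

Let L2_z k : L2 T (z k).
Proof. exact: L2D (L2_d k) (L2Z lambda (L2_Md k)). Qed.

Let Edx k : (fun t => mulop E (xs k) t - mulop E x t) = mulop P (d k).
Proof. by apply/funext => t; rewrite /mulop /d -mulmxBr -mulmxA mulKmx. Qed.

Let wd_D k : is_weak_derivative T (mulop P (d k)) (D k).
Proof.
rewrite -Edx; apply: weak_derivativeB; [| | | |exact: (wderiv_xs k).2|exact: wderiv_x.2].
- exact: L2_mulop.
- exact: L2_mulop.
- exact: (wderiv_xs k).1.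
- exact: wderiv_x.1.
Qed.

Let has_value_d k : has_value T (mulop P (d k)) 0 0.
Proof.
have [_ _ [F [cF aF F0]]] := domM_xs k; have [_ _ [G [cG aG G0]] _] := hx.
exists (fun t => F t - G t); split; last by rewrite F0 G0 subrr.
- move=> i.
  rewrite (_ : (fun t => _) = fun t : K => F t i ord0 - G t i ord0); last first.
    by apply/funext => t; rewrite !mxE.
  apply/subspace_continuousP => t Tt; apply: cvgB.
    by have /subspace_continuousP := cF i; exact.
  by have /subspace_continuousP := cG i; exact.
- rewrite -Edx; apply: lebesgue_aeW2 aF aG => t HF HG Dt.
  by rewrite (HF Dt) (HG Dt).
Qed.

Let opM_xs k t : opMx (xs k) t = opMx x t + Md k t.
Proof.
rewrite /opMx /opM /Md /D /d -/A1 !mulmxBr -!mulmxA.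
move: (wderiv _ _ t) (wderiv _ _ t) (B *m _) (A1 *m _) (A1 *m _) => a b c e f.
by apply/matrixP => i j; rewrite !mxE; ring.
Qed.

(** [A1 - N = J - R], so the differential-algebraic equation reads M x + N x = 0. *)
Let opM_x : aeq T (opMx x) (fun t => - (N *m (Q *m x t))).
Proof.
have [_ _ _] := hx; apply: lebesgue_aeW => t H Dt.
rewrite /opMx /opM (H Dt) -/A1 addrAC addrK -mulmxBl -mulmxBl -!mulNmx mulmxA.
congr (_ *m _ *m _); rewrite /A1 /N.
by apply/matrixP => i j; rewrite !mxE; ring.
Qed.

(** As M x = - N x, the function Q x satisfies both resolvent equations; subtracting it removes the
    inhomogeneity B u and leaves a linear recursion for the errors. *)
Let step k : exists v, [/\ L2 T v,
  aeq T (fun t => v t + lambda *: (N *m v t)) (fun t => d k t - lambda *: Md k t) &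
  aeq T (z k.+1) (fun t => v t - lambda *: (N *m v t))].
Proof.
have [v [y [[Lv Hv] [_ Hy] xy]]] := hxs k.
have yE : mulop (invmx Q) y = xs k.+1 by rewrite xy.
have QyE t : y t = Q *m xs k.+1 t by rewrite -yE /mulop mulKVmx.
have LQx := L2_mulop Q L2_x.
exists (fun t => v t - Q *m x t); split.
- exact: L2B (L2w_L2 Lv) LQx.
- apply: lebesgue_aeW2 Hv opM_x => t Hvt Hxt Dt.
  move: (Hvt Dt); rewrite /IaddQ mulop_invK -/opMx opM_xs (Hxt Dt) /opN -/N.
  rewrite /mulop -mulmxA mulKVmx// !mulmxBr /d mulmxBr.
  move: (N *m v t) (N *m _) (Md k t) (Q *m xs k t) (Q *m x t) => a b c e f H.
  apply/matrixP => i j; have := congr1 (fun M : 'cV[K]_n => M i j) H.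
  by rewrite !mxE; lra.
- apply: lebesgue_aeW2 Hy opM_x => t Hyt Hxt Dt.
  move: (Hyt Dt); rewrite /IaddQ yE -/opMx opM_xs (Hxt Dt) /opN -/N QyE.
  rewrite /mulop -mulmxA mulKVmx// !mulmxBr /z /d mulmxBr.
  move: (N *m v t) (N *m _) (Md k.+1 t) (Q *m xs k.+1 t) (Q *m x t) => a b c e f H.
  apply/matrixP => i j; have := congr1 (fun M : 'cV[K]_n => M i j) H.
  by rewrite !mxE; lra.
Qed.

Let dot_A1 (v : 'cV[K]_n) :
  dot (A1 *m v) v = mu * dot v (P *m v) - alpha * dot v (R *m v).
Proof.
rewrite dotC /A1 !mulmxDl mulNmx -!scalemxAl !dotDr dotNr !dotZr.
by rewrite (dot_skew _ JdT); ring.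
Qed.

Let dot_N (v : 'cV[K]_n) :
  dot v (N *m v) = mu * dot v (P *m v) + (1 - alpha) * dot v (R *m v).
Proof.
rewrite /N !mulmxDl !mulNmx mulmxDl mulNmx -!scalemxAl !dotDr dotNr dotDr dotNr !dotZr.
by rewrite (dot_skew _ JdT) (dot_skew _ JT); ring.
Qed.

Let diss k := wint T W (fun t => dot (Md k t) (d k t)).

Let quad A k := wint T W (fun t => dot (d k t) (A *m d k t)).

Let diss_ge k : quad P k + alpha * quad R k <= diss k.
Proof.
have LPd := L2_mulop P (L2_d k); have LRd := L2_mulop R (L2_d k).
have i1 := L1_dot (L2_D k) (L2_d k).
have i2 := L1_dot (L2_d k) LPd; have i3 := L1_dot (L2_d k) LRd.
have -> : diss k = wint T W (fun t => dot (D k t) (d k t)) +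
    (alpha * quad R k + - mu * quad P k).
  have j3 := L1Z alpha i3; have j2 := L1Z (- mu) i2.
  rewrite /quad -(wintZ W alpha i3) -(wintZ W (- mu) i2) -(wintD W j3 j2).
  rewrite -(wintD W i1 (L1D j3 j2)).
  congr wint; apply/funext => t.
  by rewrite /Md dotDl dotNl dot_A1 /mulop; ring.
(* This gives (mu + 1) [quad P k]; the term mu P of [A1] consumes mu of it and one copy remains. *)
have := weighted_dissipation W T0 Ppsd (L2_d k) (L2_D k) (wd_D k) (has_value_d k).
by rewrite -/(quad P k) {1}/W; lra.
Qed.

Let quad_ge0 A k : psdmx A -> 0 <= quad A k.
Proof. by move=> Apsd; apply: wint_ge0 => t; exact: psdmx_dot. Qed.

Let v k := projT1 (cid (step k)).
Let L2_v k : L2 T (v k). Proof. by rewrite /v; case: cid => ? []. Qed.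

Let quadN k := wint T W (fun t => dot (v k t) (N *m v k t)).

Let L1_N k : L1 T (fun t => dot (v k t) (N *m v k t)).
Proof. exact: L1_dot (L2_v k) (L2_mulop N (L2_v k)). Qed.

Let quadN_ge0 k : 0 <= quadN k.
Proof.
apply: wint_ge0 => t; rewrite dot_N; case/andP: alpha01 => _ a1.
by rewrite addr_ge0// mulr_ge0 ?psdmx_dot// subr_ge0.
Qed.

Let diss_ge0 k : 0 <= diss k.
Proof.
case/andP: alpha01 => a0 _; apply: le_trans (diss_ge k).
by rewrite addr_ge0 ?quad_ge0// mulr_ge0 ?quad_ge0.
Qed.

Let zz k := wint T W (fun t => sqnorm (z k t)).

Let sqnorm_DZ (a b : 'cV[K]_n) c :
  sqnorm (a + c *: b) = sqnorm a + 2 * c * dot a b + c ^+ 2 * sqnorm b.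
Proof. by rewrite !sqnormE !dotDl !dotDr !dotZl !dotZr (dotC b a); ring. Qed.

Let v_step k : aeq T (fun t => v k t + lambda *: (N *m v k t))
    (fun t => d k t - lambda *: Md k t) /\
  aeq T (z k.+1) (fun t => v k t - lambda *: (N *m v k t)).
Proof. by rewrite /v; case: cid => ? []. Qed.

(** By [v_step], z^(k+1) is v - lambda N v, while v + lambda N v = d - lambda M d. Flipping the sign
    before lambda changes the squared norm by 4 lambda <v, N v> for v and by 4 lambda <M d, d> for
    d. *)
Let energy k : zz k.+1 = zz k - 4 * lambda * (diss k + quadN k).
Proof.
have [H1 H2] := v_step k.
have iz := L1_sqnorm (L2_z k); have iN := L1_N k.
have iM := L1_dot (L2_Md k) (L2_d k).
have i1 := L1Z (- (4 * lambda)) (L1D iM iN).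
have -> : zz k - 4 * lambda * (diss k + quadN k) = wint T W (fun t =>
    sqnorm (z k t) + - (4 * lambda) *
      (dot (Md k t) (d k t) + dot (v k t) (N *m v k t))).
  by rewrite (wintD W iz i1) (wintZ W _ (L1D iM iN)) (wintD W iM iN) /zz mulNr.
apply: wint_ae; [exact: (L1_sqnorm (L2_z k.+1))|exact: L1D iz i1|].
apply: lebesgue_aeW2 H1 H2 => t E1 E2 Dt.
rewrite (E2 Dt) /z -scaleNr sqnorm_DZ sqnorm_DZ (dotC (Md k t)).
have := congr1 sqnorm (E1 Dt); rewrite -scaleNr !sqnorm_DZ.
lra.
Qed.

Let cvg_diss_quadN : diss k + quadN k @[k --> \oo] --> 0.
Proof.
apply: (@dissipation_cvg0 _ (4 * lambda) zz); first by rewrite mulr_gt0.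
- by move=> k; apply: wint_ge0 => t; exact: sqnorm_ge0.
- by move=> k; rewrite addr_ge0.
- by move=> k; rewrite energy.
Qed.

Let EPQ : E = P *m Q. Proof. by rewrite mulmxKV. Qed.

Let cvg_zz : \rank (row_mx (mu *: E) ((1 - alpha) *: R)) = n ->
  zz k @[k --> \oo] --> 0.
Proof.
rewrite [in \rank _]EPQ => rk; have [_ a1] := andP alpha01.
have a10 : 0 <= 1 - alpha by rewrite subr_ge0.
have [c c0 Hc] := coercive_of_rank Ppsd Rpsd mu0 a10 rk.
have [C C0 HC] := sqnorm_mulmx_le (1%:M - lambda *: N).
(* The shift appears because z^(k+1) = (I - lambda N) v^k is controlled by [quadN] at the previous
   index. *)
rewrite -(cvg_shiftS zz); apply: (squeeze0 (c := C / c) _ _ cvg_diss_quadN) => k.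
  by apply: wint_ge0 => t; exact: sqnorm_ge0.
rewrite (@le_trans _ _ (C / c * quadN k))//; last first.
  by rewrite ler_wpM2l ?lerDr// divr_ge0// ltW.
rewrite -(wintZ W _ (L1_N k)).
have Lr := L2B (L2_v k) (L2Z lambda (L2_mulop N (L2_v k))).
have -> : zz k.+1 = wint T W (fun t => sqnorm (v k t - lambda *: mulop N (v k) t)).
  apply: wint_ae; [exact: L1_sqnorm|exact: L1_sqnorm|].
  by apply: lebesgue_aeW (v_step k).2 => t H Dt; rewrite (H Dt).
apply: le_wint; [exact: L1_sqnorm|exact: L1Z|move=> t].
have -> : v k t - lambda *: mulop N (v k) t = (1%:M - lambda *: N) *m v k t.
  by rewrite mulmxBl mul1mx -scalemxAl.
rewrite (le_trans (HC _))// -mulrA ler_wpM2l// ler_pdivlMl// dot_N.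
exact: Hc.
Qed.

Let dd k := wint T W (fun t => sqnorm (d k t)).

Let wint_sqnorm_ge0 (f : K -> 'cV[K]_n) : 0 <= wint T W (fun t => sqnorm (f t)).
Proof. by apply: wint_ge0 => t; exact: sqnorm_ge0. Qed.

(** The cross term is nonnegative, so |z|^2 dominates both |d|^2 and lambda^2 |M d|^2; together
    these control the derivative D. *)
Let zzE k : zz k = dd k + 2 * lambda * diss k +
  lambda ^+ 2 * wint T W (fun t => sqnorm (Md k t)).
Proof.
have i1 := L1_sqnorm (L2_d k); have i2 := L1_dot (L2_Md k) (L2_d k).
have i3 := L1_sqnorm (L2_Md k).
rewrite -(wintZ W _ i2) -(wintZ W _ i3) -(wintD W i1 (L1Z _ i2)).
rewrite -(wintD W (L1D i1 (L1Z _ i2)) (L1Z _ i3)).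
congr wint; apply/funext => t.
by rewrite /z sqnorm_DZ (dotC (Md k t)).
Qed.

Let diss2_ge0 k : 0 <= 2 * lambda * diss k.
Proof. by apply: mulr_ge0 => //; apply: mulr_ge0 => //; exact: ltW. Qed.

Let dd_le k : dd k <= zz k.
Proof.
rewrite zzE -addrA lerDl; apply: addr_ge0 => //.
by apply: mulr_ge0 => //; exact: sqr_ge0.
Qed.

Let Md_le k : wint T W (fun t => sqnorm (Md k t)) <= lambda ^- 2 * zz k.
Proof.
rewrite ler_pdivlMl ?exprn_gt0// zzE lerDr; apply: addr_ge0 => //.
exact: wint_sqnorm_ge0.
Qed.

Let D_le : exists c, forall k, wint T W (fun t => sqnorm (D k t)) <= c * zz k.
Proof.
have [C C0 HC] := sqnorm_mulmx_le A1.
exists (2 * lambda ^- 2 + 2 * C) => k.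
have i1 := L1_sqnorm (L2_Md k); have i2 := L1_sqnorm (L2_d k).
have : wint T W (fun t => sqnorm (D k t)) <=
    2 * wint T W (fun t => sqnorm (Md k t)) + 2 * C * dd k.
  rewrite -(wintZ W _ i1) -(wintZ W _ i2) -(wintD W (L1Z _ i1) (L1Z _ i2)).
  apply: le_wint; [exact: L1_sqnorm|by apply: L1D; exact: L1Z|move=> t].
  have -> : D k t = Md k t + 1 *: (A1 *m d k t) by rewrite scale1r subrK.
  (* Nonnegativity of |a - b|^2 gives |a + b|^2 <= 2 |a|^2 + 2 |b|^2. *)
  have := sqnorm_ge0 (Md k t + -1 *: (A1 *m d k t)).
  by rewrite !sqnorm_DZ; have := HC (d k t); lra.
move/le_trans; apply; rewrite [leRHS]mulrDl; apply: lerD.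
  by rewrite -[leRHS]mulrA ler_wpM2l.
by rewrite ler_wpM2l// mulr_ge0.
Qed.

Lemma cvg_resolvent_argument :
  \rank (row_mx (mu *: E) ((1 - alpha) *: R)) = n ->
  cvg_L2 T (fun k => IaddQ Q lambda opMx (mulop Q (xs k)))
    (IaddQ Q lambda opMx (mulop Q x)).
Proof.
move=> rk; rewrite /cvg_L2.
have E0 k : L2norm T (fun t => IaddQ Q lambda opMx (mulop Q (xs k)) t -
    IaddQ Q lambda opMx (mulop Q x) t) =
    (Num.sqrt (\int[leb]_(t in `[0, T]) sqnorm (z k t)))%:E.
  rewrite -[RHS]/(sqrte (_)%:E) -(integral_sqnorm (L2_z k)) /L2norm.
  congr (sqrte (integral _ _ _)); apply/funext => t; congr (sqnorm _)%:E.
  rewrite /IaddQ !mulop_invK opM_xs /z /d mulmxBr.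
  rewrite /mulop scalerDr; move: (Q *m _) (Q *m _) (lambda *: _) (lambda *: _).
  by move=> a b c e; apply/matrixP => i j; rewrite !mxE; ring.
under eq_fun do rewrite E0.
apply: cvg_sqrt0; apply: (cvg_Rintegral_sqnorm (c := 1) W0 L2_z _ (cvg_zz rk)) => k.
by rewrite mul1r.
Qed.

Lemma cvg_H1_mulop : \rank (row_mx (mu *: E) ((1 - alpha) *: R)) = n ->
  cvg_H1 T (fun k => mulop E (xs k)) (mulop E x).
Proof.
move=> rk; rewrite /cvg_H1.
have LPd k := L2_mulop P (L2_d k).
have wdP k : L2 T (wderiv T (mulop P (d k))) /\
    is_weak_derivative T (mulop P (d k)) (wderiv T (mulop P (d k))).
  by apply: H1_wderiv; split=> //; exists (D k).
have E0 k : H1norm T (fun t => mulop E (xs k) t - mulop E x t) =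
    (Num.sqrt (\int[leb]_(t in `[0, T]) sqnorm (mulop P (d k) t) +
     \int[leb]_(t in `[0, T]) sqnorm (D k t)))%:E.
  rewrite Edx /H1norm (integral_sqnorm (LPd k)) (integral_sqnorm (wdP k).1).
  rewrite -EFinD /=; congr (Num.sqrt (_ + _))%:E.
  (* [H1norm] uses the weak derivative chosen for the difference, identified with [D k] almost
     everywhere by uniqueness. *)
  apply: Rintegral_ae; [exact: L1_sqnorm (wdP k).1|exact: L1_sqnorm|].
  have := weak_derivative_unique T0 (LPd k) (wdP k).1 (L2_D k) (wdP k).2 (wd_D k).
  by apply: lebesgue_aeW => t H Dt; rewrite (H Dt).
under eq_fun do rewrite E0.
apply: cvg_sqrt0; rewrite -[X in _ --> X]addr0; apply: cvgD.
  have [C C0 HC] := sqnorm_mulmx_le P.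
  apply: (cvg_Rintegral_sqnorm (c := C) (f := fun k => mulop P (d k)) W0 LPd _ (cvg_zz rk)) => k.
  have i1 := L1_sqnorm (L2_d k).
  rewrite (@le_trans _ _ (C * dd k))// ?ler_wpM2l// -(wintZ W _ i1).
  by apply: le_wint; [exact: L1_sqnorm|exact: L1Z|move=> t; exact: HC].
have [c Hc] := D_le.
exact: (cvg_Rintegral_sqnorm (c := c) W0 L2_D Hc (cvg_zz rk)).
Qed.

Lemma cvg_L2_iterates :
  \rank (row_mx (mu *: E) ((1 - alpha) *: R)) = n \/
  \rank (row_mx E (alpha *: R)) = n -> cvg_L2 T xs x.
Proof.
move=> rk; have dd0 : dd k @[k --> \oo] --> 0.
  case: rk => [rk|rk].
    apply: (squeeze0 (c := 1) _ _ (cvg_zz rk)) => k; first exact: wint_sqnorm_ge0.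
    by rewrite mul1r.
  (* Here [diss] is coercive instead of [quadN]: its lower bound has the matrix P + alpha R, with
     coefficient 1 on P whatever mu is, and it bounds d^k without passing through v^k. *)
  have [a0 _] := andP alpha01.
  move: rk; rewrite {1}EPQ -[P *m Q]scale1r => rk.
  have [c c0 Hc] := coercive_of_rank Ppsd Rpsd ler01 a0 rk.
  apply: (squeeze0 (c := c^-1) _ _ cvg_diss_quadN) => k; first exact: wint_sqnorm_ge0.
  have := diss_ge k; rewrite ler_pdivlMl// => /(le_trans _) H.
  rewrite (@le_trans _ _ (diss k)) ?lerDl//; apply: H.
  have i1 := L1_sqnorm (L2_d k).
  have i2 := L1_dot (L2_d k) (L2_mulop P (L2_d k)).
  have i3 := L1_dot (L2_d k) (L2_mulop R (L2_d k)).
  rewrite -(wintZ W _ i1) /quad -(wintZ W _ i3) -(wintD W i2 (L1Z _ i3)).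
  apply: le_wint; [exact: L1Z|exact: L1D i2 (L1Z _ i3)|move=> t].
  by have := Hc (d k t); rewrite mul1r.
have Lxx k : L2 T (fun t => xs k t - x t) by exact: L2B.
rewrite /cvg_L2.
have E0 k : L2norm T (fun t => xs k t - x t) =
    (Num.sqrt (\int[leb]_(t in `[0, T]) sqnorm (xs k t - x t)))%:E.
  by rewrite /L2norm (integral_sqnorm (Lxx k)).
under eq_fun do rewrite E0.
apply: cvg_sqrt0; have [C C0 HC] := sqnorm_mulmx_le (invmx Q).
apply: (cvg_Rintegral_sqnorm (c := C) (f := fun k t => xs k t - x t) W0 Lxx _ dd0) => k.
have i1 := L1_sqnorm (L2_d k); rewrite -(wintZ W _ i1).
apply: le_wint; [exact: L1_sqnorm|exact: L1Z|move=> t].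
by have := HC (d k t); rewrite mulKmx.
Qed.

End PeacemanRachford.

Theorem theorem26 (K : realType) (T : K) (s m : nat) (p : 'I_s -> nat)
  (E_ : forall i, 'M[K]_(p i)) (J_ : forall i j, 'M[K]_(p i, p j))
  (R_ Q_ : forall i, 'M[K]_(p i)) (B_ : forall i, 'M[K]_(p i, m))
  (E Jd J R Q : 'M[K]_(\sum_i p i)) (B : 'M[K]_(\sum_i p i, m))
  (u : K -> 'cV[K]_m) (x0 : 'cV[K]_(\sum_i p i))
  (hdata : coupled_phdae T E_ J_ R_ Q_ B_ E Jd J R Q B u x0)
  (lambda alpha mu omega : K)
  (hlambda : 0 < lambda) (halpha : 0 <= alpha <= 1) (hmu : 0 <= mu <= omega)
  (xs : nat -> K -> 'cV[K]_(\sum_i p i))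
  (hxs0 : domM T E x0 omega (xs 0%N))
  (hxs : forall k, iteration_step T E Jd J R Q B u x0 lambda alpha mu omega
                     (xs k) (xs k.+1))
  (x : K -> 'cV[K]_(\sum_i p i))
  (hx : weak_solution T E J R Q B u x0 x) :
  (\rank (row_mx (mu *: E) ((1 - alpha) *: R)) = (\sum_i p i)%N ->
     cvg_L2 T
       (fun k => IaddQ Q lambda (opM T E Jd R Q B u alpha mu)
                   (mulop Q (xs k)))
       (IaddQ Q lambda (opM T E Jd R Q B u alpha mu) (mulop Q x)) /\
     cvg_H1 T (fun k => mulop E (xs k)) (mulop E x)) /\
  (\rank (row_mx (mu *: E) ((1 - alpha) *: R)) = (\sum_i p i)%N \/
   \rank (row_mx E (alpha *: R)) = (\sum_i p i)%N ->
     cvg_L2 T xs x).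
Proof.
have [T0 [[EE RE QE] [JE JdE _]] hblocks _ _] := hdata.
have [] := ph_blocks_global hblocks; rewrite -EE -RE -QE -JE -JdE.
move=> Rpsd JT JdT Ppsd uQ; case/andP: hmu => mu0 _.
split=> rk; last first.
  exact: (cvg_L2_iterates T0 Rpsd JT JdT Ppsd uQ hlambda halpha mu0 hxs0 hxs hx rk).
split.
  exact: (cvg_resolvent_argument T0 Rpsd JT JdT Ppsd uQ hlambda halpha mu0 hxs0 hxs hx rk).
exact: (cvg_H1_mulop T0 Rpsd JT JdT Ppsd uQ hlambda halpha mu0 hxs0 hxs hx rk).
Qed.
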